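(* Let $n$, $k\geq 1$ and $l$ be integers with $0\leq l<n$ and $l\neq 0$, and let $\lambda$ be a partition. Then, as formal power series in the variables $\{x_{i,j}: i\in\mathbb{Z}/n\mathbb{Z},\ j\in\frac1n\mathbb{Z}\}$, \[ 0=\sum_\sigma (-1)^{ht(\sigma\setminus\lambda)}\,s^l_\sigma[n], \] where the sum is over all partitions $\sigma$ obtained from $\lambda$ by adding a border strip of length $kn$.
   Context: A partition is identified with its Young diagram (English convention: rows justified to the northwest, row $i$ having $\lambda_i$ boxes, rows and columns indexed from $1$). The box $\square$ in row $i$ and column $j$ has content $c(\square):=j-i\in\mathbb{Z}$ and color $j-i \bmod n$. A semi-standard Young tableau (SSYT) of $\lambda$ is an assignment of positive integers to the boxes of $\lambda$, weakly increasing from left to right along rows and strictly increasing from top to bottom along columns; $w(\square,T)$ is the number in box $\square$ of $T$. Shifted weight: $w^l(\square,T):=w(\square,T)+\frac{l\cdot c(\square)}{n}\in\frac1n\mathbb{Z}$, where $c(\square)$ is the integer content (not reduced modulo $n$). $l$-shifted loop Schur function: $s^l_\lambda[n]:=\sum_T x^{T,l}$, the sum over all SSYT $T$ of $\lambda$, where $x^{T,l}:=\prod_{\square\in\lambda}x_{c(\square)\bmod n,\ w^l(\square,T)}$. Border strip: $\sigma$ is obtained from $\lambda$ by adding a length $m$ border strip if $\sigma\supset\lambda$ are Young diagrams such that the complement $\sigma\setminus\lambda$ is connected (boxes adjacent along edges), contains exactly $m$ boxes, and contains no $2\times 2$ square. The height $ht(\sigma\setminus\lambda)$ is the number of rows occupied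 by $\sigma\setminus\lambda$, minus $1$. *)

(* Defs.v *)
From HB Require Import structures.
From mathcomp Require Import all_boot all_order all_algebra archimedean finmap.
From mathcomp.multinomials Require Import monalg.
From mathcomp Require Import boolp classical_sets functions cardinality fsbigop.

Set Implicit Arguments.
Unset Strict Implicit.
Unset Printing Implicit Defensive.

Import Order.TTheory GRing.Theory Num.Theory.

Local Open Scope fset_scope.
Local Open Scope classical_set_scope.
Local Open Scope ring_scope.

Record int_partition := IntPartition {
  parts :> seq nat;
  partsP : sorted geq parts && (0%N \notin parts)
}.

HB.instance Definition _ := [isSub for parts].
HB.instance Definition _ := [Countable of int_partition by <:].

(** A box is a pair (row, column). Rows and columns are numbered from 0, which
    does not affect the content. *)
Definition diagram (lam : int_partition) : {fset nat * nat} :=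
  [fset b in [seq (i, j) | i <- iota 0 (size lam),
                           j <- iota 0 (nth 0%N lam i)]].

Lemma in_diagram (lam : int_partition) b :
  (b \in diagram lam) = (b.2 < nth 0 lam b.1)%N.
Proof.
case: b => i j; rewrite inE; apply/allpairsPdep/idP => /=.
  by case=> x [y] [_ + [-> ->]]; rewrite mem_iota.
move=> ltj; exists i, j; split; rewrite ?mem_iota //=.
by rewrite add0n ltnNge; apply: contraTN ltj => /(nth_default _) ->.
Qed.

Definition content (b : nat * nat) : int := b.2%:Z - b.1%:Z.

Definition adjacent (b c : nat * nat) : bool :=
  [|| (b.1 == c.1) && (b.2.+1 == c.2), (b.1 == c.1) && (c.2.+1 == b.2),
      (b.2 == c.2) && (b.1.+1 == c.1) | (b.2 == c.2) && (c.1.+1 == b.1)].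

Definition edge_connected (D : {fset nat * nat}) : Prop :=
  forall b c : D, connect (fun x y : D => adjacent (val x) (val y)) b c.

Definition has_square (D : {fset nat * nat}) : Prop :=
  exists i j : nat, [/\ (i, j) \in D, (i, j.+1) \in D,
                        (i.+1, j) \in D & (i.+1, j.+1) \in D].

Definition skew_diagram (sigma lam : int_partition) : {fset nat * nat} :=
  (diagram sigma `\` diagram lam)%fset.

Definition adds_border_strip (m : nat) (lam sigma : int_partition) : Prop :=
  let D := skew_diagram sigma lam in
  [/\ (diagram lam `<=` diagram sigma)%fset, edge_connected D, #|` D| = m
    & ~ has_square D].

(** The truncated predecessor is harmless: border strips of positive length
    occupy at least one row. *)
Definition height (sigma lam : int_partition) : nat :=
  #|` [fset b.1 | b in skew_diagram sigma lam]%fset|.-1.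

(** Hence a finitely supported sum over these [sigma] never takes the default
    value 0 that it has on infinite supports. *)
Lemma finite_adds_border_strip m lam :
  finite_set [set sigma | adds_border_strip m lam sigma].
Proof.
pose N := (#|` diagram lam| + m)%N.
have bnd (sigma : int_partition) : adds_border_strip m lam sigma ->
    (size sigma <= N)%N /\ forall i, (nth 0 sigma i <= N)%N.
  case=> sub _ card _.
  have cardN : #|` diagram sigma| = N.
    by rewrite /N -card -(cardfsID (diagram lam)) (fsetIidPr sub).
  split.
    rewrite -cardN -(size_iota 0 (size sigma)).
    rewrite -(size_map (fun i => (i, 0%N))) cardfE cardE.
    rewrite -(size_map val); apply: uniq_leq_size.
      by rewrite map_inj_uniq ?iota_uniq // => x y [].
    move=> b /mapP[i]; rewrite mem_iota /= add0n => lti ->.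
    have pos : (i, 0%N) \in diagram sigma.
      rewrite in_diagram /= lt0n; case/andP: (partsP sigma) => _.
      by apply: contraNneq => <-; rewrite mem_nth.
    by apply/mapP; exists [` pos]; rewrite ?mem_enum.
  move=> i.
  rewrite -cardN -(size_iota 0 (nth 0%N sigma i)).
  rewrite -(size_map (fun j => (i, j))) cardfE cardE.
  rewrite -(size_map val); apply: uniq_leq_size.
    by rewrite map_inj_uniq ?iota_uniq // => x y [].
  move=> b /mapP[j]; rewrite mem_iota /= add0n => ltj ->.
  have pos : (i, j) \in diagram sigma by rewrite in_diagram.
  by apply/mapP; exists [` pos]; rewrite ?mem_enum.
pose g (s : N.-bseq 'I_N.+1) : int_partition :=
  insubd lam (map (@nat_of_ord N.+1) s).
apply: (@sub_finite_set _ _ (range g)); last exact: finite_image.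
move=> sigma /= /bnd[szN nthN].
have szt : (size (map (@inord N) sigma) <= N)%N by rewrite size_map.
exists (Bseq szt) => //; apply: val_inj.
have E : map (@nat_of_ord N.+1) (map (@inord N) sigma) = sigma.
  rewrite -map_comp -[RHS]map_id; apply/eq_in_map => x /(nthP 0%N)[i _ <-] /=.
  by rewrite inordK // ltnS.
by rewrite /g /= E val_insubd partsP.
Qed.

Definition filling (lam : int_partition) := {ffun diagram lam -> nat}.

Definition is_ssyt (lam : int_partition) (T : filling lam) : Prop :=
  [/\ forall b, (0 < T b)%N,
      forall b c, (val b).1 = (val c).1 -> ((val b).2 < (val c).2)%N ->
        (T b <= T c)%N
    & forall b c, (val b).2 = (val c).2 -> ((val b).1 < (val c).1)%N ->
        (T b < T c)%N].

(** (1/n)Z, for 0 < n. *)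
Definition frac (n : nat) := {q : rat | n%:R * q \is a Num.int}.

(** The first component is Z/nZ as soon as 1 < n, which is the only case of
    interest here: a shift l satisfies 0 < l < n. *)
Definition loop_var (n : nat) := ('Z_n * frac n)%type.

(** A power series is the family of its coefficients, indexed by the monomials
    in finitely many of the variables. Sums and scalar multiples are pointwise;
    the pointwise product which functions also carry is not the product of
    power series and is not used. *)
Notation power_series R n := ({cmonom (loop_var n)} -> R^o).

Definition monomial_series (R : comNzRingType) (n : nat)
    (m : {cmonom (loop_var n)}) : power_series R n :=
  fun m' => (m' == m)%:R.

(** Meaningful when every monomial occurs in finitely many of the [f i]: a
    coefficient with an infinite support would get the default value 0. For
    the sum over tableaux below this is [finite_tableau_monomial]. *)
Definition series_sum (R : comNzRingType) (n : nat) (I : choiceType)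
    (A : set I) (f : I -> power_series R n) : power_series R n :=
  fun m => \sum_(i \in A) f i m.

Section ShiftedLoopSchur.
Variables (R : comNzRingType) (n : nat) (l : int) (lam : int_partition).
Implicit Types (b : diagram lam) (T : filling lam).

Definition color (b : nat * nat) : 'Z_n := (content b)%:~R.

Definition shifted_weight T b : rat :=
  (T b)%:R + l%:~R * (content (val b))%:~R / n%:R.

Lemma shifted_weightP T b : n%:R * shifted_weight T b \is a Num.int.
Proof.
rewrite /shifted_weight mulrDr rpredD //; first by rewrite rpredM ?natr_int.
have [->|n0] := eqVneq n 0%N; first by rewrite mul0r rpred0.
by rewrite mulrC divfK ?pnatr_eq0 // rpredM ?intr_int.
Qed.

Definition tableau_var T b : loop_var n :=
  (color (val b), exist _ (shifted_weight T b) (shifted_weightP T b)).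

Definition tableau_monomial T : {cmonom (loop_var n)} :=
  \big[mmul/mone]_(b : diagram lam) ucm (tableau_var T b).

Definition shifted_loop_schur : power_series R n :=
  series_sum [set T | is_ssyt T]
             (fun T => monomial_series R (tableau_monomial T)).

Lemma finite_tableau_monomial (m : {cmonom (loop_var n)}) :
  finite_set [set T | is_ssyt T /\ tableau_monomial T = m].
Proof.
pose g (f : {ffun diagram lam -> finsupp m}) : filling lam :=
  [ffun b => `|numq (val (val (f b)).2
                     - l%:~R * (content (val b))%:~R / n%:R)|%N].
apply: (@sub_finite_set _ _ (range g)); last exact: finite_image.
move=> T [_ mT].
have inm b : tableau_var T b \in finsupp m.
  rewrite -cmE_neq0 -mT /tableau_monomial (bigD1 b) //= cmM cmU eqxx.
  by rewrite add1n.
exists [ffun b => [` inm b]] => //; apply/ffunP => b.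
by rewrite /g ffunE ffunE /= /shifted_weight addrK [X in numq X]pmulrn numq_int.
Qed.

End ShiftedLoopSchur.

Arguments tableau_monomial n l {lam} T.
Arguments shifted_loop_schur R n l lam : clear implicits.

(* Main.v *)
Require Import Defs.
From mathcomp Require Import all_boot all_order all_algebra archimedean finmap.
From mathcomp.multinomials Require Import monalg mpoly.
From mathcomp Require Import boolp classical_sets functions cardinality fsbigop.
From mathcomp Require Import zify ring.

(** Put [y c w = x_(c mod n, w + l c / n)] for an integer content [c] and an
    entry [w]. A shifted loop Schur function is then the sum over tableaux [T]
    of the products of the [y (content b) (T b)], and the whole effect of the
    loop structure is the quasi-periodicity [y (c + n) w = y c (w + l)].

    Schur functions whose variables depend on the content in this way still
    have a Jacobi-Trudi formula ([tableau_sum_jacobi_trudi]): with rows and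
    columns numbered from 0, they are the determinants of the matrices
    [H(-j, lam_i - i)], where [H(p, q)] sums the products of the [y c w_c] over
    the weakly increasing words [w_p, ..., w_(q-1)]. Let [g_q] be the row vector
    [(H(-j, q))_(j < r)]. Adding a border strip of length [d = k n] replaces one
    of the numbers [q_i = lam_i - i] by [q_i + d], and sorting them again costs
    the sign given by the height ([strip_det_sum]). So the signed sum over
    border strips is the sum over [i] of the determinants in which row [i],
    which was [g_(q_i)], is replaced by [g_(q_i + d)].

    The point is that the shift is linear: there is a matrix [X], independent
    of [lam], with [g_(q + d) = g_q X] for all [q > -r]. Indeed, by
    quasi-periodicity [H(-j, q + d)] is [H(-j - d, q)] restricted to the entries
    larger than [k l]; forbidding the smallest entries one after the other acts
    on the first argument of [H] as a difference operator, which yields a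
    combination of the [H(-j - d + t, q)] with [0 <= t <= k l < d]. Those whose
    first argument is at most [-r] are eliminated by a linear recurrence, whose
    order is the number of available entries ([shift_matrix_exists]). Now the
    sum over [i] is [tr X] times the Jacobi-Trudi determinant of [lam]
    ([sum_det_replace_row]).

    To have finitely many entries, fix the monomial [m] whose coefficient is
    wanted and send the variables that do not occur in [m] to 0, the others to
    the variables of a polynomial ring over the integers. Then [y c w = 0] once
    [w + l c / n] exceeds a bound [K]. At contents down to [-(r + d)] this leaves
    about [K + l (r + d) / n] entries, which is at most [r] for large [r]
    because [l < n]. As [l > 0], no entry is left at large contents, so [g_q = 0]
    for large [q] and [X] is nilpotent; over a domain its trace is 0
    ([nilpotent_trace0]). *)

Set Implicit Arguments.
Unset Strict Implicit.
Unset Printing Implicit Defensive.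

Import Order.TTheory GRing.Theory Num.Theory.

Local Open Scope ring_scope.

(** * Complete homogeneous sums with content-dependent variables *)

Section Homogeneous.
Variables (A : comNzRingType) (y : int -> nat -> A).

(** The words [w_p <= w_(p+1) <= ...] of length [m] with letters in
    [(u, u + w]], read from the right: either the largest letter [u + w] does
    not occur, or it is the last letter. *)
Fixpoint hcomplete_len (u w : nat) (p : int) : nat -> A :=
  if w is w'.+1 then
    fix rec m := if m is m'.+1
      then hcomplete_len u w' p m + y (p + m'%:Z) (u + w')%N.+1 * rec m' else 1
  else fun m => (m == 0%N)%:R.

Definition hcomplete (u w : nat) (p q : int) : A :=
  if p <= q then hcomplete_len u w p `|q - p|%N else 0.

Lemma hcomplete_len0 u w p : hcomplete_len u w p 0 = 1.
Proof. by case: w. Qed.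

Lemma hcomplete_lenS u w p m :
  hcomplete_len u w.+1 p m.+1 =
  hcomplete_len u w p m.+1 + y (p + m%:Z) (u + w)%N.+1 * hcomplete_len u w.+1 p m.
Proof. by []. Qed.

Lemma hcomplete_len_first u w p m :
  hcomplete_len u w.+1 p m.+1 =
  hcomplete_len u.+1 w p m.+1 + y p u.+1 * hcomplete_len u w.+1 (p + 1) m.
Proof.
elim: w m => [|w IHw] m.
  elim: m => [|m IHm].
    by rewrite hcomplete_lenS /= addr0 addn0.
  rewrite hcomplete_lenS IHm /= !add0r addn0 mulrA [y _ _ * y _ _]mulrC -mulrA.
  by congr (_ * (y _ _ * _)); rewrite -addrA -intS.
elim: m => [|m IHm].
  rewrite hcomplete_lenS [hcomplete_len u w.+1 p 1]IHw.
  rewrite [hcomplete_len u.+1 w.+1 p 1]hcomplete_lenS.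
  by rewrite !hcomplete_len0 addr0 !mulr1 addrAC addSnnS.
rewrite hcomplete_lenS IHm [hcomplete_len u w.+1 p m.+2]IHw.
rewrite [hcomplete_len u.+1 w.+1 p m.+2]hcomplete_lenS.
rewrite [hcomplete_len u w.+2 (p + 1) m.+1]hcomplete_lenS.
rewrite addSnnS -[p + 1 + _]addrA -intS.
ring.
Qed.

Lemma hcomplete_eq0 u w p q : q < p -> hcomplete u w p q = 0.
Proof. by rewrite /hcomplete leNgt => ->. Qed.

Lemma hcomplete_id u w p : hcomplete u w p p = 1.
Proof. by rewrite /hcomplete lexx subrr hcomplete_len0. Qed.

Lemma hcomplete0 u p q : hcomplete u 0 p q = (p == q)%:R.
Proof.
rewrite /hcomplete /=; case: ltgtP => [lt_pq|//|->]; last by rewrite subrr.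
by rewrite absz_eq0 subr_eq0 gt_eqF.
Qed.

(** The same alternative for the largest letter; it holds for all [p] and [q]
    because the sum vanishes for [q < p]. *)
Lemma hcomplete_last u w p q :
  hcomplete u w.+1 p q =
  hcomplete u w p q + y (q - 1) (u + w)%N.+1 * hcomplete u w.+1 p (q - 1).
Proof.
case: (ltgtP p q) => [lt_pq|lt_qp|<-].
- have [m ->] : exists m : nat, q = p + m.+1%:Z by exists `|q - p|.-1%N; lia.
  rewrite /hcomplete !ifT; [|lia..].
  rewrite (_ : `|_|%N = m.+1); last lia.
  rewrite (_ : absz (_ - 1 - p)%R = m); last lia.
  by rewrite hcomplete_lenS; congr (_ + y _ _ * _); lia.
- by rewrite !hcomplete_eq0 ?mulr0 ?addr0 //; lia.
- by rewrite !hcomplete_id hcomplete_eq0 ?mulr0 ?addr0 //; lia.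
Qed.

(** Mirror image of the previous recursion: the smallest letter is absent, or
    it is the first one. Read backwards, forbidding the smallest letter is the
    difference operator [f p - y p u.+1 * f (p + 1)] in the first argument. *)
Lemma hcomplete_first u w p q :
  hcomplete u w.+1 p q =
  hcomplete u.+1 w p q + y p u.+1 * hcomplete u w.+1 (p + 1) q.
Proof.
case: (ltgtP p q) => [lt_pq|lt_qp|<-].
- have [m ->] : exists m : nat, q = p + m.+1%:Z by exists `|q - p|.-1%N; lia.
  rewrite /hcomplete !ifT; [|lia..].
  rewrite (_ : `|_|%N = m.+1); last lia.
  rewrite (_ : absz (_ - (p + 1))%R = m); last lia.
  exact: hcomplete_len_first.
- by rewrite !hcomplete_eq0 ?mulr0 ?addr0 //; lia.
- by rewrite !hcomplete_id hcomplete_eq0 ?mulr0 ?addr0 //; lia.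
Qed.

Lemma hcomplete_shift d s u w p q :
  (forall c v, (0 < v)%N -> y (c + d) v = y c (v + s)%N) ->
  hcomplete u w (p + d) (q + d) = hcomplete (u + s) w p q.
Proof.
move=> per; rewrite /hcomplete lerD2r opprD addrACA subrr addr0.
case: ifP => // _; move: `|_|%N => m.
elim: w m => [//|w IHw] m; elim: m => [//|m IHm].
by rewrite !hcomplete_lenS IHw IHm addrAC per // addnAC addSn.
Qed.

Lemma hcomplete_top_weights u w v p q :
  (forall c x, p <= c -> (u + w < x)%N -> y c x = 0) ->
  hcomplete u (w + v) p q = hcomplete u w p q.
Proof.
move=> y0; elim: v => [|v IHv]; first by rewrite addn0.
rewrite addnS hcomplete_last IHv.
have [le_pq|lt_qp] := lerP p (q - 1); first by rewrite y0 ?mul0r ?addr0 //; lia.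
by rewrite [X in _ * X]hcomplete_eq0 // mulr0 addr0.
Qed.

Lemma hcomplete_vanish u w p q :
  p < q -> (forall v, (0 < v)%N -> y (q - 1) v = 0) -> hcomplete u w p q = 0.
Proof.
move=> lt_pq y0; elim: w => [|w IHw]; first by rewrite hcomplete0 lt_eqF.
by rewrite hcomplete_last IHw y0 // mul0r addr0.
Qed.

End Homogeneous.

(** * The trace in sums of determinants *)

(** The scalar matrix ['X^e], being equal to ['X^e - X^e], is a multiple of
    ['X - X]; so the characteristic polynomial divides a power of ['X], and
    over a domain it is then itself a power of ['X]. *)
Lemma nilpotent_trace0 (A : idomainType) r (X : 'M[A]_r.+1) e :
  X ^+ e = 0 -> \tr X = 0.
Proof.
move=> X0.
have: char_poly X %| ('X - 0%:P) ^+ (e * r.+1).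
  rewrite subr0.
  have -> : 'X^(e * r.+1) = \det ('X%:M ^+ e : 'M[{poly A}]_r.+1).
    by rewrite -rmorphXn /= det_scalar exprM.
  have -> : 'X%:M ^+ e = 'X%:M ^+ e - map_mx polyC X ^+ e.
    by rewrite -[map_mx _ _ ^+ _]rmorphXn X0 rmorph0 subr0.
  rewrite subrXX_comm; last by rewrite /GRing.comm; apply: comm_scalar_mx.
  by rewrite det_mulmx dvdp_mulr.
case/dvdp_exp_XsubCP => k _; rewrite subr0.
rewrite eqp_monic ?char_poly_monic ?monicXn // => /eqP E.
have k_r : k = r.+1.
  by have := size_char_poly X; rewrite E size_polyXn => -[].
have := char_poly_trace X (ltn0Sn r).
by rewrite E coefXn k_r ltn_eqF // => /eqP; rewrite eq_sym oppr_eq0 => /eqP.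
Qed.

(** Expanding along the replaced rows turns the sum into the trace of
    [M X adj(M)], and [adj(M) M] is the scalar [det M]. *)
Lemma sum_det_replace_row (A : comNzRingType) r (M X : 'M[A]_r) :
  \sum_(i < r) \det (\matrix_(a, b) (if a == i then (M *m X) a b else M a b))
  = \tr X * \det M.
Proof.
have -> : \tr X * \det M = \tr (M *m X *m \adj M).
  rewrite -mulmxA mxtrace_mulC -mulmxA mul_adj_mx mxtrace_mulC mul_scalar_mx.
  by rewrite mxtraceZ mulrC.
apply: eq_bigr => i _; rewrite (expand_det_row _ i) mxE.
apply: eq_bigr => j _; rewrite !mxE eqxx; congr (_ * (_ * \det _)).
by apply/matrixP=> a b; rewrite !mxE eq_sym (negPf (neq_lift _ _)).
Qed.

(** * The shift matrix and its trace *)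

(** In the application [r] is large, [d = k n], [s = k l], and [W] bounds the
    entries that occur at contents at least [-(r + d)]. *)
Section Shift.
Variables (A : idomainType) (y : int -> nat -> A) (r' W d s : nat).
Local Notation r := r'.+1.
Hypothesis W_le : (W <= r)%N.
Hypothesis s_le : (s <= W)%N.
Hypothesis s_lt_d : (s < d)%N.
Hypothesis y_per :
  forall c v, (0 < v)%N -> y (c + d%:Z) v = y c (v + s)%N.
Hypothesis y_heavy :
  forall c v, - (r + d)%N%:Z <= c -> (W < v)%N -> y c v = 0.
Variable C : int.
Hypothesis y_far : forall c v, C <= c -> (0 < v)%N -> y c v = 0.

(** Only the arguments [q > -r] matter: these are all the values that
    [lam_i - i] takes for [i < r]. *)
Definition in_column_span (f : int -> A) : Prop :=
  exists x : 'I_r -> A, forall q, - r%:Z < q ->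
    f q = \sum_(j < r) hcomplete y 0 W (- j%:Z) q * x j.

Lemma in_column_spanD a f g :
  in_column_span f -> in_column_span g ->
  in_column_span (fun q => f q + a * g q).
Proof.
case=> x Ex [z Ez]; exists (fun j => x j + a * z j) => q lt_q.
rewrite Ex // Ez // mulr_sumr -big_split /=; apply: eq_bigr => j _.
by rewrite mulrDr mulrCA.
Qed.

Lemma eq_in_column_span f g :
  (forall q, f q = g q) -> in_column_span f -> in_column_span g.
Proof. by move=> E [x Ex]; exists x => q /Ex; rewrite E. Qed.

(** Iterating the difference operator of [hcomplete_first] [u] times uses the
    columns [p], ..., [p + u]. *)
Lemma in_column_span_drop u p : (u <= W)%N ->
  (forall t, (t <= u)%N -> in_column_span (hcomplete y 0 W (p + t%:Z))) ->
  in_column_span (hcomplete y u (W - u) p).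
Proof.
elim: u p => [|u IHu] p le_uW span_p.
  by rewrite subn0; have := span_p 0%N isT; rewrite addr0.
have := in_column_spanD (- y p u.+1) (f := hcomplete y u (W - u) p)
  (g := hcomplete y u (W - u) (p + 1)).
move/(_ _ _)/(eq_in_column_span _); apply.
- move=> q; have -> : (W - u)%N = (W - u.+1).+1 by lia.
  by rewrite hcomplete_first mulNr addrK.
- by apply: IHu => [|t le_t]; [exact: ltnW|apply: span_p; exact: leqW].
- apply: IHu => [|t le_t]; first exact: ltnW.
  by rewrite -addrA -intS; apply: span_p.
Qed.

(** For [m >= r], forbidding all the [W] entries leaves the indicator of
    [q = -m], which vanishes for [q > -r]. Undoing this one entry at a time
    expresses the column [-m] through the [W] columns to its right, and
    [W <= r] keeps these at nonpositive contents. *)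
Lemma in_column_span_all m : in_column_span (hcomplete y 0 W (- m%:Z)).
Proof.
elim/ltn_ind: m => m IHm; have [lt_mr|le_rm] := ltnP m r.
  exists (fun j => (j == Ordinal lt_mr)%:R) => q _.
  rewrite (bigD1 (Ordinal lt_mr)) //= eqxx mulr1 big1 ?addr0 // => j /negPf->.
  by rewrite mulr0.
suff H v u : (u + v)%N = W -> in_column_span (hcomplete y u v (- m%:Z)).
  exact: (H W 0%N).
elim: v u => [|v IHv] u Euv.
  exists (fun=> 0) => q lt_q; rewrite big1 => [|j _]; last by rewrite mulr0.
  by rewrite hcomplete0 (_ : _ == _ = false) //; apply/negbTE; lia.
have := in_column_spanD (y (- m%:Z) u.+1) (f := hcomplete y u.+1 v (- m%:Z))
  (g := hcomplete y u v.+1 (- m%:Z + 1)).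
move/(_ _ _)/(eq_in_column_span _); apply.
- by move=> q; rewrite [RHS]hcomplete_first.
- by apply: IHv; rewrite addSnnS.
have -> : v.+1 = (W - u)%N by lia.
apply: in_column_span_drop => [|t le_tu]; first lia.
have -> : - m%:Z + 1 + t%:Z = - (m - t.+1)%N%:Z by lia.
by apply: IHm; lia.
Qed.

(** Quasi-periodicity moves the shift of [q] to the first argument, at the
    price of forbidding the entries up to [s]. Since [s < d], the columns
    [-j - d], ..., [-j - d + s] needed to undo this are all at nonpositive
    contents. *)
Lemma shift_matrix_exists :
  exists X : 'M[A]_r, forall (q : int) (j : 'I_r), - r%:Z < q ->
    hcomplete y 0 W (- j%:Z) (q + d%:Z) =
    \sum_(b < r) hcomplete y 0 W (- b%:Z) q * X b j.
Proof.
have span j : in_column_span (fun q => hcomplete y 0 W (- (j : 'I_r)%:Z) (q + d%:Z)).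
  apply: (@eq_in_column_span (hcomplete y s (W - s) (- (j + d)%N%:Z))) => [q|].
    have -> : - j%:Z = - (j + d)%N%:Z + d%:Z by lia.
    rewrite (hcomplete_shift _ _ _ _ y_per) add0n -{2}(subnK s_le).
    rewrite hcomplete_top_weights // => c x le_c lt_x; apply: y_heavy; last by lia.
    by have := ltn_ord j; lia.
  apply: in_column_span_drop => // t le_t.
  have -> : - (j + d)%N%:Z + t%:Z = - (j + d - t)%N%:Z by lia.
  exact: in_column_span_all.
have [x Ex] := fin_all_exists span.
exists (\matrix_(b, j) x j b) => q j lt_q; rewrite Ex //.
by apply: eq_bigr => b _; rewrite mxE.
Qed.

(** The rows [g_0, g_(-1), ..., g_(-(r-1))] form a unitriangular matrix [U], and
    row [i] of [U X^e] is [g_(e d - i)], which is 0 for large [e]. *)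
Lemma shift_matrix_trace0 :
  exists X : 'M[A]_r, \tr X = 0 /\ forall (q : int) (j : 'I_r), - r%:Z < q ->
    hcomplete y 0 W (- j%:Z) (q + d%:Z) =
    \sum_(b < r) hcomplete y 0 W (- b%:Z) q * X b j.
Proof.
have [X EX] := shift_matrix_exists; exists X; split=> //.
pose U : 'M[A]_r := \matrix_(i, j) hcomplete y 0 W (- j%:Z) (- i%:Z).
have U_unit : U \in unitmx.
  rewrite unitmxE -det_tr det_trig; last first.
    apply/is_trig_mxP => i j lt_ij; rewrite !mxE hcomplete_eq0 //; lia.
  by rewrite big1 ?unitr1 // => i _; rewrite !mxE hcomplete_id.
have EU e i j : (U *m X ^+ e) i j = hcomplete y 0 W (- j%:Z) (- i%:Z + (e * d)%N%:Z).
  elim: e i j => [|e IHe] i j; first by rewrite mulmx1 mxE mul0n addr0.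
  rewrite exprSr mulmxA mxE; under eq_bigr do rewrite IHe.
  rewrite -EX; last by have := ltn_ord i; lia.
  by congr hcomplete; lia.
apply: (@nilpotent_trace0 _ _ _ (`|C| + r.+1)).
rewrite -[LHS]mul1mx -(mulVmx U_unit) -mulmxA; set Z := U *m _.
have -> : Z = 0; last by rewrite mulmx0.
apply/matrixP => i j; rewrite EU mxE; have lt_ir := ltn_ord i.
have le_e : (`|C| + r.+1 <= (`|C| + r.+1) * d)%N by rewrite leq_pmulr //; lia.
by apply: hcomplete_vanish => [|v]; [|apply: y_far]; lia.
Qed.

Lemma sum_det_shift_row0 (q : 'I_r -> int) : (forall i, - r%:Z < q i) ->
  \sum_(i < r) \det (\matrix_(a < r, b < r)
    hcomplete y 0 W (- b%:Z) (if a == i then q a + d%:Z else q a)) = 0.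
Proof.
move=> lt_q; have [X [trX EX]] := shift_matrix_trace0.
pose M : 'M[A]_r := \matrix_(a, b) hcomplete y 0 W (- b%:Z) (q a).
transitivity (\tr X * \det M); last by rewrite trX mul0r.
rewrite -sum_det_replace_row.
apply: eq_bigr => i _; congr (\det _); apply/matrixP => a b; rewrite !mxE.
case: ifP => // _; rewrite EX //; apply: eq_bigr => c _.
by rewrite mxE.
Qed.

End Shift.

(** * Tableaux and the Jacobi-Trudi formula *)

Section Tableaux.
Variables (r m W : nat).
Local Notation shape := {ffun 'I_r -> 'I_m.+1}.
Local Notation array := {ffun 'I_r * 'I_m -> 'I_W.+1}.

Definition rowlen (nu : shape) (i : nat) : nat :=
  oapp (fun k : 'I_r => nu k : nat) 0%N (insub i).

Definition antitone (nu : shape) := forall i, (rowlen nu i.+1 <= rowlen nu i)%N.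

(** Equivalently, [lam / nu] is a horizontal strip. *)
Definition interlaces (lam nu : shape) : bool :=
  [forall i : 'I_r, (rowlen lam i.+1 <= nu i <= lam i)%N].

(** Tableaux of all shapes inside the [r * m] rectangle share one finite type:
    the value 0 marks the boxes outside the shape. *)
Definition tableau (w : nat) (nu : shape) (T : array) : bool :=
  [&& [forall b : 'I_r * 'I_m, (T b != 0%N :> nat) == (b.2 < nu b.1)%N],
      [forall b : 'I_r * 'I_m, (T b <= w)%N],
      [forall b : 'I_r * 'I_m, forall c : 'I_r * 'I_m,
         [&& b.1 == c.1, b.2 < c.2 & T c != 0%N :> nat]%N ==> (T b <= T c)%N]
    & [forall b : 'I_r * 'I_m, forall c : 'I_r * 'I_m,
         [&& b.2 == c.2, b.1 < c.1 & T c != 0%N :> nat]%N ==> (T b < T c)%N]].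

Lemma tableauP w (nu : shape) (T : array) :
  reflect [/\ forall (i : 'I_r) (j : 'I_m), (T (i, j) != 0%N :> nat) = (j < nu i)%N,
              forall b, (T b <= w)%N,
              forall (i : 'I_r) (j k : 'I_m), (j < k)%N -> T (i, k) != 0%N :> nat ->
                (T (i, j) <= T (i, k))%N
            & forall (i k : 'I_r) (j : 'I_m), (i < k)%N -> T (k, j) != 0%N :> nat ->
                (T (i, j) < T (k, j))%N]
          (tableau w nu T).
Proof.
apply: (iffP and4P) => -[Hs Hw Hr Hc]; split.
- by move=> i j; move/forallP/(_ (i, j))/eqP: Hs.
- by apply/forallP.
- move=> i j k lt_jk n0.
  have /forallP/(_ (i, k))/implyP := forallP Hr (i, j).
  by apply; rewrite /= eqxx lt_jk.
- move=> i k j lt_ik n0.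
  have /forallP/(_ (k, j))/implyP := forallP Hc (i, j).
  by apply; rewrite /= eqxx lt_ik.
- by apply/forallP => -[i j]; rewrite Hs.
- by apply/forallP.
- apply/forallP => -[i j]; apply/forallP => -[k l] /=; apply/implyP.
  by case/and3P => /eqP <-; apply: Hr.
- apply/forallP => -[i j]; apply/forallP => -[k l] /=; apply/implyP.
  by case/and3P => /eqP <-; apply: Hc.
Qed.

Lemma rowlen_ord nu (i : 'I_r) : rowlen nu i = nu i.
Proof. by rewrite /rowlen valK. Qed.

Lemma rowlen_default nu i : (r <= i)%N -> rowlen nu i = 0%N.
Proof. by move=> le_ri; rewrite /rowlen insubF // ltnNge le_ri. Qed.

Lemma antitone_le nu i k : antitone nu -> (i <= k)%N ->
  (rowlen nu k <= rowlen nu i)%N.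
Proof.
move=> anti /subnK <-; elim: (k - i)%N => // d IHd.
by rewrite addSn; apply: leq_trans IHd; apply: anti.
Qed.

Lemma interlaces_antitone lam nu : interlaces lam nu -> antitone nu.
Proof.
move/forallP=> il i; have [lt_ir|le_ri] := ltnP i.+1 r; last first.
  by rewrite (rowlen_default _ le_ri).
have lt_ir' := ltnW lt_ir.
rewrite (rowlen_ord nu (Ordinal lt_ir)) (rowlen_ord nu (Ordinal lt_ir')).
have /andP[_ le1] := il (Ordinal lt_ir); have /andP[le2 _] := il (Ordinal lt_ir').
by apply: leq_trans le1 _; rewrite -rowlen_ord.
Qed.

Lemma card_ord_lt (j : nat) : (j <= m)%N -> #|[pred i : 'I_m | (i < j)%N]| = j.
Proof.
move=> le_jm; rewrite -sum1_card -(big_ord_widen_cond _ xpredT (fun=> 1%N)) //.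
by rewrite sum1_card card_ord.
Qed.

Lemma downward_closed_card (P : pred 'I_m) :
  (forall j k : 'I_m, (j < k)%N -> P k -> P j) ->
  forall j : 'I_m, P j = (j < #|P|)%N.
Proof.
move=> down j; apply/idP/idP => [Pj|].
  rewrite -[X in (X <= _)%N](@card_ord_lt j.+1) //.
  apply: subset_leq_card; apply/fintype.subsetP => i; rewrite inE ltnS leq_eqVlt.
  by case/predU1P => [/val_inj->//|/down]; apply.
apply: contraTT => nPj; rewrite -leqNgt.
rewrite -[X in (_ <= X)%N](@card_ord_lt j); last exact: ltnW.
apply: subset_leq_card; apply/fintype.subsetP => i Pi; rewrite inE ltnNge leq_eqVlt.
by apply: contra nPj => /predU1P[/val_inj->//|/down]; apply.
Qed.

(** The shape of the part of a tableau with entries at most [w]: in each row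
    these entries form an initial segment, so counting them suffices. *)
Definition truncate_shape (w : nat) (T : array) : shape :=
  [ffun i => inord #|[pred j | (0 < T (i, j) <= w)%N]|].

Definition truncate (w : nat) (T : array) : array :=
  [ffun b => if (T b <= w)%N then T b else ord0].

(** Inverse of [truncate]: the boxes of [lam] that are still empty receive the
    entry [w]. *)
Definition fill_with (w : nat) (lam : shape) (T : array) : array :=
  [ffun b => if (T b == ord0) && (b.2 < lam b.1)%N then inord w else T b].

Lemma truncate_shapeE w nu T : tableau w.+1 nu T ->
  forall i (j : 'I_m), (j < truncate_shape w T i)%N = (0 < T (i, j) <= w)%N.
Proof.
case/tableauP => Hs _ Hr _ i j; rewrite ffunE inordK; last first.
  by rewrite ltnS -[X in (_ <= X)%N]card_ord max_card.
rewrite -downward_closed_card // => {}j k lt_jk /=.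
rewrite !lt0n !Hs => /andP[lt_k le_w]; rewrite (ltn_trans lt_jk lt_k) /=.
by apply: leq_trans le_w; apply: Hr; rewrite ?Hs.
Qed.

Lemma truncate_interlaces w lam T : antitone lam -> tableau w.+1 lam T ->
  interlaces lam (truncate_shape w T).
Proof.
move=> anti tabT; case/tableauP: (tabT) => Hs Hw Hr Hc.
apply/forallP => i; apply/andP; split; last first.
  rewrite leqNgt; apply/negP => lt_i.
  have lt_m : (lam i < m)%N.
    by apply: leq_trans lt_i _; rewrite -ltnS ltn_ord.
  have := truncate_shapeE tabT i (Ordinal lt_m).
  by rewrite /= lt_i lt0n Hs ltnn.
have [lt_ir|le_ri] := ltnP i.+1 r; last by rewrite rowlen_default.
rewrite (rowlen_ord _ (Ordinal lt_ir)) leqNgt; apply/negP => lt_i.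
have lt_m : (truncate_shape w T i < m)%N.
  by apply: leq_trans lt_i _; rewrite -ltnS ltn_ord.
have := truncate_shapeE tabT i (Ordinal lt_m).
rewrite ltnn lt0n Hs /= => /esym /negP; apply; apply/andP; split.
  apply: leq_trans lt_i _; have := anti i.
  by rewrite rowlen_ord (rowlen_ord _ (Ordinal lt_ir)).
rewrite -ltnS; apply: leq_trans (Hw (Ordinal lt_ir, Ordinal lt_m)).
by apply: Hc; rewrite //= Hs.
Qed.

Lemma truncate_tableau w lam T : tableau w.+1 lam T ->
  tableau w (truncate_shape w T) (truncate w T).
Proof.
move=> tabT; case/tableauP: (tabT) => Hs Hw Hr Hc; apply/tableauP; split.
- move=> i j; rewrite (truncate_shapeE tabT) ffunE -lt0n.
  by case: ifP; rewrite ?andbT ?andbF.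
- by move=> b; rewrite ffunE; case: ifP.
- move=> i j k lt_jk; rewrite !ffunE; case: ifP => // le_w n0.
  by rewrite ifT ?Hr // (leq_trans _ le_w) // Hr.
- move=> i k j lt_ik; rewrite !ffunE; case: ifP => // le_w n0.
  have lt_T := Hc i k j lt_ik n0.
  by rewrite ifT ?lt_T // ltnW // (leq_trans lt_T).
Qed.

Lemma truncateK w lam T : (w < W)%N -> tableau w.+1 lam T ->
  fill_with w.+1 lam (truncate w T) = T.
Proof.
move=> lt_wW /tableauP[Hs Hw Hr Hc]; apply/ffunP => -[i j]; rewrite !ffunE /=.
have [le_w|lt_w] := leqP (T (i, j)) w.
  by case: ifP => // /andP[/eqP T0]; rewrite -Hs T0.
rewrite eqxx -Hs -lt0n (leq_ltn_trans _ lt_w) //=.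
by apply: val_inj; apply/eqP; rewrite /= inordK // eqn_leq lt_w Hw.
Qed.

Lemma fill_with_tableau w lam nu T : (w < W)%N -> antitone lam ->
  interlaces lam nu -> tableau w nu T -> tableau w.+1 lam (fill_with w.+1 lam T).
Proof.
move=> lt_wW anti /forallP il /tableauP[Hs Hw Hr Hc].
have fill_withE b : (fill_with w.+1 lam T b : nat) =
    if (T b == 0%N :> nat) && (b.2 < lam b.1)%N then w.+1 else T b.
  by rewrite ffunE -val_eqE /=; case: ifP => // _; rewrite inordK.
have sub i (j : 'I_m) : T (i, j) != 0%N :> nat -> (j < lam i)%N.
  by rewrite Hs => lt_j; apply: leq_trans lt_j _; case/andP: (il i).
apply/tableauP; split.
- move=> i j; rewrite fill_withE /=.
  have [T0|T0] /= := eqVneq (T (i, j) : nat) 0%N; last by rewrite T0 sub.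
  by case: ifP => // _; rewrite T0.
- by move=> b; rewrite fill_withE; case: ifP => // _; apply: leqW.
- move=> i j k lt_jk; rewrite !fill_withE /=.
  have [Tk0|Tk0] /= := eqVneq (T (i, k) : nat) 0%N.
    case: (ltnP k (lam i)) => [lt_k _|_]; last by rewrite Tk0.
    by case: ifP => // _; apply: leqW.
  move=> _; rewrite ifF; first exact: Hr.
  by rewrite -[LHS]negbK negb_and Hs (ltn_trans lt_jk) // -Hs.
- move=> i k j lt_ik; rewrite !fill_withE /= => n0.
  have lt_k : (j < lam k)%N.
    have [T0|/sub//] := eqVneq (T (k, j) : nat) 0%N.
    by move: n0; rewrite T0 /=; case: ltnP.
  have Tij : T (i, j) != 0%N :> nat.
    rewrite Hs; case/andP: (il i) => le_i _; apply: leq_trans le_i.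
    by apply: leq_trans lt_k _; rewrite -(rowlen_ord lam k); apply: antitone_le.
  rewrite (negPf Tij) /=; move: n0; rewrite lt_k andbT.
  have [_ _|Tk0 _] := eqVneq (T (k, j) : nat) 0%N; last exact: Hc.
  by rewrite ltnS.
Qed.

Lemma fill_withK w lam nu T : (w < W)%N -> interlaces lam nu -> tableau w nu T ->
  truncate w (fill_with w.+1 lam T) = T.
Proof.
move=> lt_wW /forallP il /tableauP[Hs Hw Hr Hc]; apply/ffunP => -[i j].
rewrite !ffunE /=; case: eqP => [T0|_] /=; last by rewrite Hw.
by case: (j < lam i)%N; [rewrite inordK // ltnn T0|rewrite T0].
Qed.

Lemma fill_with_shape w lam nu T : (w < W)%N -> antitone lam -> interlaces lam nu ->
  tableau w nu T -> truncate_shape w (fill_with w.+1 lam T) = nu.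
Proof.
move=> lt_wW anti il tabT; have tabF := fill_with_tableau lt_wW anti il tabT.
have := truncate_tableau tabF; rewrite (fill_withK lt_wW il tabT).
case/tableauP: tabT => Hs _ _ _; case/tableauP => Hs' _ _ _.
apply/ffunP => i; apply: val_inj; apply/eqP; rewrite /= eqn_leq.
apply/andP; split; rewrite leqNgt; apply/negP => lt_i.
  have lt_m : (nu i < m)%N by apply: leq_trans lt_i _; rewrite -ltnS ltn_ord.
  by have := Hs' i (Ordinal lt_m); rewrite Hs /= ltnn lt_i.
have lt_m : (truncate_shape w (fill_with w.+1 lam T) i < m)%N.
  by apply: leq_trans lt_i _; rewrite -ltnS ltn_ord.
by have := Hs' i (Ordinal lt_m); rewrite Hs /= ltnn lt_i.
Qed.

Variables (A : comNzRingType) (y : int -> nat -> A).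

Definition tableau_sum (w : nat) (lam : shape) : A :=
  \sum_(T | tableau w lam T)
    \prod_(b : 'I_r * 'I_m | (b.2 < lam b.1)%N) y (b.2%:Z - b.1%:Z) (T b).

(** Removing the largest entry [w.+1] is a bijection from the tableaux of shape
    [lam] to the pairs of an interlacing shape [nu] and a tableau of shape
    [nu]. *)
Lemma tableau_sum_rec w lam : (w < W)%N -> antitone lam ->
  tableau_sum w.+1 lam =
  \sum_(nu | interlaces lam nu)
    (\prod_(b : 'I_r * 'I_m | (nu b.1 <= b.2 < lam b.1)%N)
      y (b.2%:Z - b.1%:Z) w.+1) * tableau_sum w nu.
Proof.
move=> lt_wW anti.
rewrite /tableau_sum (partition_big (truncate_shape w) (interlaces lam)) /=;
  last by move=> T; apply: truncate_interlaces.
apply: eq_bigr => nu il; rewrite big_distrr /=.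
rewrite (reindex_onto (fill_with w.+1 lam) (truncate w)) /=; last first.
  by move=> T /andP[tabT _]; apply: truncateK.
have E T : (tableau w.+1 lam (fill_with w.+1 lam T) &&
      (truncate_shape w (fill_with w.+1 lam T) == nu)) &&
      (truncate w (fill_with w.+1 lam T) == T) = tableau w nu T.
  apply/idP/idP => [/andP[/andP[tabF /eqP <-] /eqP E]|tabT].
    by have := truncate_tableau tabF; rewrite E.
  by rewrite (fill_with_tableau lt_wW anti il tabT) (fill_with_shape lt_wW anti il tabT)
    (fill_withK lt_wW il tabT) !eqxx.
rewrite (eq_bigl _ _ E); apply: eq_bigr => T /tableauP[Hs Hw _ _].
rewrite (bigID (fun b : 'I_r * 'I_m => (b.2 < nu b.1)%N)) /= mulrC.
have sub i : (nu i <= lam i)%N by case/andP: (forallP il i).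
congr (_ * _); apply: eq_big => -[i j] /=.
- by rewrite -leqNgt andbC.
- case/andP => lt_j; rewrite -Hs negbK => /eqP T0.
  by rewrite ffunE /= lt_j -val_eqE /= T0 eqxx inordK.
- by apply: andb_idl => lt_j; apply: leq_trans lt_j _.
- case/andP => lt_j lt_j'; congr y; rewrite ffunE /=.
  by rewrite -val_eqE /= ifF // (negPf (_ : T (i, j) != 0%N :> nat)) // Hs.
Qed.

Definition jacobi_trudi (w : nat) (lam : shape) : A :=
  \det (\matrix_(i < r, j < r) hcomplete y 0 w (- j%:Z) ((lam i)%:Z - i%:Z)).

(** Peeling off the last letter repeatedly: [b - v] counts the final letters
    that are equal to [w.+1], and the words in which more than [b - a] final
    letters are equal to [w.+1] are subtracted on the left. *)
Lemma hcomplete_last_iter w p (i : int) a b : (a <= b)%N ->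
  hcomplete y 0 w.+1 p (b%:Z - i)
  - (y (a%:Z - i - 1) w.+1 * \prod_(a <= j < b) y (j%:Z - i) w.+1)
    * hcomplete y 0 w.+1 p (a%:Z - i - 1) =
  \sum_(a <= v < b.+1)
     (\prod_(v <= j < b) y (j%:Z - i) w.+1) * hcomplete y 0 w p (v%:Z - i).
Proof.
move=> /subnKC <-; elim: (b - a)%N => [|d IHd].
  rewrite addn0 big_nat1 !big_geq // mulr1 mul1r hcomplete_last add0n.
  by rewrite addrK.
rewrite addnS [RHS]big_nat_recr /=; last by rewrite leqW // leq_addr.
under [X in _ = X + _]eq_big_nat => v /andP[_ lt_v] do rewrite big_nat_recr //= mulrAC.
rewrite -big_distrl /= -IHd.
rewrite big_nat_recr ?leq_addr //=.
rewrite hcomplete_last add0n [\prod_((a + d).+1 <= j < _) _]big_geq // mul1r.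
have -> : (a + d).+1%:Z - i - 1 = (a + d)%N%:Z - i by lia.
ring.
Qed.

(** Subtract from each row the multiple of the next row given by
    [hcomplete_last_iter] with [b = lam_i] and [a = lam_(i+1)]. Row [i] becomes
    a sum over the values [nu_i] between [lam_(i+1)] and [lam_i], so
    multilinearity produces exactly the interlacing shapes, each with the
    weight of its horizontal strip. For the last row, [a = 0] and the subtracted
    row is zero. *)
Lemma jacobi_trudi_rec w lam : antitone lam ->
  jacobi_trudi w.+1 lam =
  \sum_(nu | interlaces lam nu)
    (\prod_(b : 'I_r * 'I_m | (nu b.1 <= b.2 < lam b.1)%N)
      y (b.2%:Z - b.1%:Z) w.+1) * jacobi_trudi w nu.
Proof.
move=> anti; rewrite /jacobi_trudi; set M := \matrix_(i, j) hcomplete y 0 w.+1 _ _.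
pose c (i : 'I_r) : A := let a := rowlen lam i.+1 in
  y (a%:Z - i%:Z - 1) w.+1 * \prod_(a <= j < lam i) y (j%:Z - i%:Z) w.+1.
(* Left multiplication by [L] subtracts [c i] times row [i + 1] from row [i]. *)
pose L : 'M[A]_r := \matrix_(i, k) ((k == i)%:R - (k == i.+1 :> nat)%:R * c i).
have detL : \det L = 1.
  rewrite -det_tr det_trig; last first.
    by apply/is_trig_mxP => i k lt_ik; rewrite !mxE -val_eqE /=;
       rewrite !ltn_eqF ?mul0r ?subr0 // leqW.
  apply: big1 => i _; rewrite !mxE eqxx.
  by rewrite ltn_eqF ?mul0r ?subr0.
pose wt (i : 'I_r) (v : nat) : A :=
  \prod_(j < m | (v <= j < lam i)%N) y (j%:Z - i%:Z) w.+1.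
have LM : L *m M = \matrix_(i, j)
    \sum_(v : 'I_m.+1 | (rowlen lam i.+1 <= v <= lam i)%N)
       wt i v * hcomplete y 0 w (- j%:Z) (v%:Z - i%:Z).
  apply/matrixP => i j; rewrite !mxE.
  transitivity (hcomplete y 0 w.+1 (- j%:Z) ((lam i)%:Z - i%:Z) -
     c i * hcomplete y 0 w.+1 (- j%:Z) ((rowlen lam i.+1)%:Z - i%:Z - 1)).
    under eq_bigr => k _ do rewrite !mxE mulrBl.
    rewrite sumrB; congr (_ - _).
      rewrite (bigD1 i) //= eqxx mul1r big1 ?addr0 // => k /negPf->.
      by rewrite mul0r.
    have [lt_ir|le_ri] := ltnP i.+1 r.
      rewrite (bigD1 (Ordinal lt_ir)) //= eqxx mul1r big1 ?addr0 => [|k].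
        rewrite (rowlen_ord _ (Ordinal lt_ir)) /=.
        by congr (_ * hcomplete _ _ _ _ _); lia.
      by rewrite -val_eqE /= => /negPf->; rewrite !mul0r.
    rewrite big1 => [|k _].
      rewrite rowlen_default // hcomplete_eq0 ?mulr0 //.
      by have := ltn_ord j; lia.
    by rewrite ltn_eqF ?mul0r // (leq_trans _ le_ri).
  rewrite hcomplete_last_iter; last by rewrite -rowlen_ord; apply: anti.
  have le_m : (lam i < m.+1)%N by [].
  rewrite (big_nat_widenl _ 0) // (big_nat_widen _ _ m.+1) // big_mkord.
  apply: eq_big => [v|v /andP[]]; first by rewrite ltnS andbC.
  move=> _ le_v; congr (_ * _).
  rewrite (big_nat_widenl _ 0) // (big_nat_widen _ _ m) //.
  by rewrite big_mkord; apply: eq_bigl => j'; rewrite andbC.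
transitivity (\det (L *m M)); first by rewrite det_mulmx detL mul1r.
rewrite LM /determinant.
under eq_bigr => s _.
  under eq_bigr => i _ do rewrite mxE.
  rewrite (bigA_distr_big_dep _
    (fun i (v : 'I_m.+1) => wt i v * hcomplete _ _ _ _ _)) /=.
  rewrite big_distrr /=; over.
rewrite exchange_big /=; apply: eq_big => [nu|nu _].
  by apply/familyP/forallP.
rewrite big_distrr /=; apply: eq_bigr => s _.
rewrite big_split /= mulrCA; congr (_ * (_ * _)).
  by rewrite /wt pair_big_dep.
by apply: eq_bigr => i _; rewrite !mxE.
Qed.

Lemma tableau_sum_jacobi_trudi w lam : (w <= W)%N -> antitone lam ->
  tableau_sum w lam = jacobi_trudi w lam.
Proof.
elim: w lam => [|w IHw] lam le_wW anti; last first.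
  rewrite tableau_sum_rec // jacobi_trudi_rec //; apply: eq_bigr => nu il.
  by rewrite IHw ?(ltnW le_wW) //; apply: interlaces_antitone il.
rewrite /tableau_sum /jacobi_trudi.
have [/forallP lam0|] := boolP [forall i, lam i == 0%N :> nat].
  rewrite (big_pred1 [ffun=> ord0]) => [|T]; last first.
    apply/tableauP/eqP => [[_ T0 _ _]|->].
      apply/ffunP => b; apply: val_inj; have := T0 b.
      by rewrite ffunE leqn0 => /eqP.
    by split=> [i j|b|i j k _|i k j _]; rewrite !ffunE // (eqP (lam0 i)).
  rewrite big1 => [|b]; last by rewrite (eqP (lam0 _)).
  rewrite (_ : \matrix_(i, j) _ = 1%:M) ?det1 //; apply/matrixP => i j.
  rewrite !mxE hcomplete0 (eqP (lam0 i)) -val_eqE; congr (nat_of_bool _)%:R.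
  by apply/eqP/eqP => /= ?; lia.
rewrite negb_forall => /existsP[i lam_i].
rewrite big1 => [|T /tableauP[Hs Hw _ _]]; last first.
  have lt_m : (0 < m)%N.
    by rewrite -ltnS; apply: leq_ltn_trans (ltn_ord (lam i)); rewrite lt0n.
  have := Hs i (Ordinal lt_m); rewrite /= lt0n lam_i.
  by have := Hw (i, Ordinal lt_m); rewrite leqn0 => ->.
have lt0r : (0 < r)%N by apply: leq_ltn_trans (ltn_ord i).
rewrite (expand_det_row _ (Ordinal lt0r)) big1 // => j _.
rewrite !mxE hcomplete0 /= subr0.
have : (lam i <= rowlen lam 0)%N by rewrite -rowlen_ord; apply: antitone_le.
rewrite (rowlen_ord _ (Ordinal lt0r)) => le_lam.
rewrite (_ : _ == _ = false) ?mul0r //; apply/negbTE; lia.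
Qed.

End Tableaux.

(** * Border strips as sets of rows *)

Section Strips.
Implicit Types lam sigma : int_partition.
Local Open Scope nat_scope.

Lemma nth_parts_le lam i j : i <= j -> nth 0 lam j <= nth 0 lam i.
Proof.
move=> le_ij; have [lt_j|le_j] := ltnP j (size lam); last by rewrite nth_default.
have /andP[srt _] := partsP lam.
apply: (@sorted_leq_nth _ geq _ _ 0 _ srt) => //; rewrite ?inE //.
- by move=> a b c /= ? ?; lia.
- by move=> a /=.
- exact: leq_ltn_trans lt_j.
Qed.

Lemma nth_parts_gt0 lam i : (0 < nth 0 lam i) = (i < size lam).
Proof.
have [lt_i|le_i] := ltnP i (size lam); last by rewrite nth_default.
have /andP[_ n0] := partsP lam; rewrite lt0n; apply: contraNneq n0 => <-.
exact: mem_nth.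
Qed.

Lemma eq_partition lam sigma : (forall i, nth 0 lam i = nth 0 sigma i) ->
  lam = sigma.
Proof.
move=> E; apply: val_inj; apply: (@eq_from_nth _ 0) => //=.
have H i : (i < size lam) = (i < size sigma) by rewrite -!nth_parts_gt0 E.
have := H (size lam); have := H (size sigma); rewrite !ltnn; lia.
Qed.

Lemma partition_exists (f : nat -> nat) N :
  (forall i, f i.+1 <= f i) -> (forall i, N <= i -> f i = 0) ->
  exists lam : int_partition, forall i, nth 0 lam i = f i.
Proof.
move=> anti f0; pose k := find (fun i => f i == 0) (iota 0 N).
have le_kN : k <= N by rewrite -[X in _ <= X](size_iota 0) find_size.
have anti_le i d : f (i + d) <= f i.
  by elim: d => [|d IHd]; rewrite ?addn0 // addnS; apply: leq_trans IHd.
have fpos i : i < k -> 0 < f i.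
  move=> lt_ik; have := before_find 0 lt_ik.
  by rewrite nth_iota ?add0n ?lt0n => [->//|]; apply: leq_trans le_kN.
have fk0 i : k <= i -> f i = 0.
  move=> le_ki; have fk : f k = 0.
    have [lt_kN|le_Nk] := ltnP k N; last exact: f0.
    have hs : has (fun i => f i == 0) (iota 0 N) by rewrite has_find size_iota.
    by have := nth_find 0 hs; rewrite nth_iota // => /eqP.
  by apply/eqP; rewrite -leqn0 -fk -(subnKC le_ki).
have ok : sorted geq (mkseq f k) && (0 \notin mkseq f k).
  apply/andP; split; last first.
    by apply/mapP => -[i]; rewrite mem_iota /= => /fpos; lia.
  apply/(sortedP 0) => i; rewrite size_mkseq => lt_i.
  rewrite !nth_mkseq //=; first exact: ltnW.
exists (IntPartition ok) => i /=; have [lt_ik|le_ki] := ltnP i k.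
  by rewrite nth_mkseq.
by rewrite nth_default ?size_mkseq // fk0.
Qed.

Lemma in_skew sigma lam a b :
  ((a, b) \in skew_diagram sigma lam) = (nth 0 lam a <= b < nth 0 sigma a).
Proof. by rewrite /skew_diagram in_fsetD !in_diagram -leqNgt. Qed.

Lemma card_skew sigma lam N : size sigma <= N ->
  #|` skew_diagram sigma lam| = \sum_(a < N) (nth 0 sigma a - nth 0 lam a).
Proof.
move=> le_N.
pose s := [seq (a, b) | a <- iota 0 N,
  b <- iota (nth 0 lam a) (nth 0 sigma a - nth 0 lam a)].
have -> : skew_diagram sigma lam = [fset b in s]%fset.
  apply/fsetP => -[a b]; rewrite in_skew inE; apply/idP/allpairsPdep.
    move=> lt_b; exists a, b; split=> //; rewrite mem_iota /=; last lia.
    by rewrite (leq_trans _ le_N) // -nth_parts_gt0; lia.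
  by case=> x [z] [_ + [-> ->]]; rewrite mem_iota; lia.
rewrite card_fseq undup_id; last first.
  by apply: allpairs_uniq_dep => [|a _|[a b] [c e] _ _ [-> ->]//];
    rewrite iota_uniq.
rewrite size_allpairs_dep sumnE big_map.
rewrite -(big_mkord xpredT (fun a => nth 0 sigma a - nth 0 lam a)).
by rewrite /index_iota subn0; apply: eq_bigr => i _; rewrite size_iota.
Qed.

(** The border strip occupies the rows [t], ..., [i]: each of these rows but
    the topmost ends one box beyond the previous row of [lam]. *)
Definition strip (d : nat) lam sigma (t i : nat) : Prop :=
  [/\ t <= i,
      forall s, (s < t) || (i < s) -> nth 0 sigma s = nth 0 lam s,
      forall s, t <= s < i -> nth 0 sigma s.+1 = (nth 0 lam s).+1,
      nth 0 sigma t + i = nth 0 lam i + d + t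
    & nth 0 lam t < nth 0 sigma t].

Lemma strip_row d lam sigma t i : strip d lam sigma t i ->
  forall s, t <= s <= i -> nth 0 lam s < nth 0 sigma s.
Proof.
case=> le_ti _ mid _ top s /andP[]; rewrite leq_eqVlt => /predU1P[<-//|].
case: s => // s lt_ts lt_si; rewrite mid ?ltnS; last lia.
exact: nth_parts_le.
Qed.

(** The lengths of the rows of the strip telescope, since
    [sigma_(s+1) = lam_s + 1]. *)
Lemma strip_sum lam sigma t e :
  (forall s, t <= s < t + e -> nth 0 sigma s.+1 = (nth 0 lam s).+1) ->
  nth 0 lam t < nth 0 sigma t ->
  \sum_(t <= a < (t + e).+1) (nth 0 sigma a - nth 0 lam a) + nth 0 lam (t + e)
  = nth 0 sigma t + e.
Proof.
move=> mid top; elim: e mid => [|e IHe] mid.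
  by rewrite addn0 big_nat1 addn0 subnK // ltnW.
rewrite big_nat_recr /=; last by lia.
have {}IHe := IHe (fun s lt_s => mid s ltac:(lia)).
have := mid (t + e) ltac:(lia); rewrite -!addnS.
have := nth_parts_le lam (leqnSn (t + e)).
rewrite -!addnS in IHe *; lia.
Qed.

Lemma card_strip lam sigma t i :
  t <= i ->
  (forall s, (s < t) || (i < s) -> nth 0 sigma s = nth 0 lam s) ->
  (forall s, t <= s < i -> nth 0 sigma s.+1 = (nth 0 lam s).+1) ->
  nth 0 lam t < nth 0 sigma t ->
  #|` skew_diagram sigma lam| + nth 0 lam i + t = nth 0 sigma t + i.
Proof.
move=> le_ti out mid top.
rewrite (@card_skew _ _ (size sigma + i.+1)) ?leq_addr //.
rewrite -(big_mkord xpredT (fun a => nth 0 sigma a - nth 0 lam a)).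
rewrite (@big_cat_nat _ _ _ i.+1) ?leq_addl //=.
rewrite (@big_cat_nat _ _ _ t 0 i.+1) ?leqW //=.
have out0 a b : (b <= t) || (i < a) ->
    \sum_(a <= s < b) (nth 0 sigma s - nth 0 lam s) = 0.
  move=> H; rewrite big_nat big1 // => s /andP[le_as lt_sb].
  by rewrite out ?subnn //; lia.
rewrite (out0 0 t) ?leqnn // (out0 i.+1) ?leqnn ?orbT //.
have := @strip_sum lam sigma t (i - t); rewrite subnKC // => H.
have := H mid top; lia.
Qed.

Lemma strip_height d lam sigma t i : strip d lam sigma t i ->
  height sigma lam = i - t.
Proof.
move=> str; case: (str) => le_ti out mid _ top.
rewrite /height; have -> : [fset b.1 | b in skew_diagram sigma lam]%fset =
    [fset a in iota t (i - t).+1]%fset.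
  apply/fsetP => a; rewrite !inE mem_iota; apply/imfsetP/idP => /=.
    case=> -[x z]; rewrite in_skew /= => lt_z ->.
    by move: lt_z; have [/out->|] := boolP ((x < t) || (i < x)); lia.
  move=> le_a; exists (a, nth 0 lam a) => //; rewrite in_skew leqnn /=.
  apply: (strip_row str); lia.
by rewrite card_fseq undup_id ?iota_uniq // size_iota.
Qed.

(** Every box is joined to the first box of its row, and the first box of row
    [s < i], in column [lam_s], lies above the last box of row [s + 1]. *)
Lemma strip_adds d lam sigma t i : strip d lam sigma t i ->
  adds_border_strip d lam sigma.
Proof.
move=> str; case: (str) => le_ti out mid Ed top.
have le_row s : nth 0 lam s <= nth 0 sigma s.
  have [le_ts|lt_st] := leqP t s; last by rewrite out ?lt_st.
  have [le_si|lt_is] := leqP s i; last by rewrite out ?lt_is ?orbT.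
  by apply/ltnW/(strip_row str); rewrite le_ts.
have inD a b : (a, b) \in skew_diagram sigma lam -> t <= a <= i.
  by rewrite in_skew; have [/out->|] := boolP ((a < t) || (i < a)); lia.
split.
- apply/fsubsetP => -[a b]; rewrite !in_diagram /= => lt_b.
  exact: leq_trans (le_row a).
- set D := skew_diagram _ _ in inD *.
  pose e := fun x y : D => adjacent (val x) (val y).
  change (forall b c : D, connect e b c).
  have sym : connect_sym e.
    by apply: sym_connect_sym => x y; rewrite /e /adjacent; lia.
  have left_end k a b (h : (a, b) \in D) (h0 : (a, nth 0 lam a) \in D) :
      b = nth 0 lam a + k -> connect e [` h]%fset [` h0]%fset.
    elim: k b h => [|k IHk] b h Eb.
      rewrite addn0 in Eb; subst b.
      by rewrite (bool_irrelevance h h0).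
    have h1 : (a, nth 0 lam a + k) \in D by move: h; rewrite /D !in_skew; lia.
    apply: connect_trans (IHk _ h1 erefl); apply: connect1.
    by rewrite /e /adjacent /=; lia.
  have h i' : t <= i' <= i -> (i', nth 0 lam i') \in D.
    by move=> le_i; rewrite /D in_skew leqnn; apply: (strip_row str).
  have hi := h i ltac:(lia).
  have down k a (ha : (a, nth 0 lam a) \in D) : a + k = i ->
      connect e [` ha]%fset [` hi]%fset.
    elim: k a ha => [|k IHk] a ha Eai.
      have Ea : a = i by lia.
      by subst a; rewrite (bool_irrelevance ha hi).
    have /andP[le_ta _] := inD _ _ ha.
    have h1 : (a.+1, nth 0 lam a) \in D.
      rewrite /D in_skew mid; last lia.
      by have := nth_parts_le lam (leqnSn a); lia.
    have h2 := h a.+1 ltac:(lia).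
    apply: connect_trans (IHk _ h2 ltac:(lia)).
    apply: (@connect_trans _ _ [` h1]%fset).
      by apply: connect1; rewrite /e /adjacent /=; lia.
    apply: (left_end (nth 0 lam a - nth 0 lam a.+1)).
    by have := nth_parts_le lam (leqnSn a); lia.
  have to_base (b : D) : connect e b [` hi]%fset.
    case: b => -[a b] hb; have := inD _ _ hb => le_a.
    have h0 := h _ le_a.
    apply: connect_trans (down (i - a) _ h0 ltac:(lia)).
    apply: (left_end (b - nth 0 lam a)).
    by move: (hb); rewrite /D in_skew; lia.
  move=> b c; apply: connect_trans (to_base b) _; rewrite sym; exact: to_base.
- by have := card_strip le_ti out mid top; lia.
- case=> a [b] []; move=> h1 h2 h3 h4.
  have := inD _ _ h1; have := inD _ _ h4 => le1 le2.
  move: h1 h4; rewrite !in_skew mid; lia.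
Qed.

(** Let [t] and [i] be the first and last occupied rows. If
    [sigma_(s+1) >= lam_s + 2], the strip has a square in rows [s] and [s + 1].
    If [sigma_(s+1) <= lam_s], these two rows of the strip share no column, and
    the boxes in rows up to [s] are a union of connected components. *)
Lemma adds_strip d lam sigma : 0 < d -> adds_border_strip d lam sigma ->
  exists t i, strip d lam sigma t i.
Proof.
move=> d_gt0 [sub conn card nosq].
have le_row s : nth 0 lam s <= nth 0 sigma s.
  rewrite leqNgt; apply/negP => lt_s.
  have /fsubsetP/(_ (s, nth 0 sigma s)) := sub.
  by rewrite !in_diagram /= lt_s ltnn => /(_ isT).
pose occ s := nth 0 lam s < nth 0 sigma s.
have occ_ex : exists s, occ s.
  move: d_gt0; rewrite -card cardfs_gt0 => /fset0Pn[[a b]].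
  by rewrite in_skew => H; exists a; rewrite /occ; lia.
have occ_bd s : occ s -> s <= size sigma.
  by rewrite /occ => H; rewrite ltnW // -nth_parts_gt0; lia.
case: (ex_minnP occ_ex) => t occ_t min_t.
case: (ex_maxnP occ_ex occ_bd) => i occ_i max_i.
have le_ti := min_t _ occ_i.
have out s : (s < t) || (i < s) -> nth 0 sigma s = nth 0 lam s.
  move=> H; apply/eqP; rewrite eqn_leq le_row andbT leqNgt; apply/negP => occ_s.
  by have := min_t _ occ_s; have := max_i _ occ_s; lia.
have mid s : t <= s < i -> nth 0 sigma s.+1 = (nth 0 lam s).+1.
  move=> lt_s; apply/eqP; rewrite eqn_leq; apply/andP; split.
    rewrite leqNgt; apply/negP => lt_sq; apply: nosq; exists s, (nth 0 lam s).
    have := nth_parts_le lam (leqnSn s); have := nth_parts_le sigma (leqnSn s).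
    by rewrite !in_skew; split; lia.
  rewrite ltnNge; apply/negP => le_s.
  set D := skew_diagram _ _ in conn card.
  have ht : (t, nth 0 lam t) \in D by rewrite /D in_skew leqnn.
  have hi : (i, nth 0 lam i) \in D by rewrite /D in_skew leqnn.
  pose e := fun x y : D => adjacent (val x) (val y).
  have con : connect e [` ht]%fset [` hi]%fset := conn _ _.
  have cl : closed e [pred b : D | (val b).1 <= s].
    apply: intro_closed => [|[[a b] h] [[a' b'] h']].
      by apply: sym_connect_sym => x y; rewrite /e /adjacent; lia.
    rewrite /e /adjacent !inE /= => adj le_as.
    rewrite leqNgt; apply/negP => lt_sa.
    have [Ea Ea' Eb] : [/\ a = s, a' = s.+1 & b = b'] by split; lia.
    by move: h h'; rewrite /D !in_skew Ea Ea' Eb; lia.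
  have := closed_connect cl con; rewrite !inE /=; lia.
exists t, i; split=> //.
by have := card_strip le_ti out mid occ_t; rewrite card; lia.
Qed.

End Strips.

(** * Border strips and determinants *)

(** The position of the bead number [s] of the Maya diagram of [lam]. *)
Definition beta (lam : int_partition) (s : nat) : int := (nth 0%N lam s)%:Z - s%:Z.

Section StripSum.
Implicit Types lam sigma : int_partition.

Lemma beta_lt lam s s' : (s < s')%N -> beta lam s' < beta lam s.
Proof. by rewrite /beta => lt_s; have := nth_parts_le lam (ltnW lt_s); lia. Qed.

Lemma beta_le lam s s' : (s <= s')%N -> beta lam s' <= beta lam s.
Proof. by rewrite /beta => lt_s; have := nth_parts_le lam lt_s; lia. Qed.

Lemma strip_top d lam sigma t i : strip d lam sigma t i ->
  beta sigma t = beta lam i + d%:Z.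
Proof. by case=> _ _ _ E _; rewrite /beta; lia. Qed.

(** In terms of beads, the bead [i] jumps by [d] over the beads [t], ...,
    [i - 1]; in particular [i] determines [t]. *)
Lemma strip_split d lam sigma t i : strip d lam sigma t i ->
  forall s, if (s < t)%N then beta lam i + d%:Z < beta lam s
            else beta lam s < beta lam i + d%:Z.
Proof.
move=> str s; rewrite -(strip_top str); case: str => _ out _ _ top.
case: ifP => [lt_st|/negbT]; last rewrite -leqNgt => le_ts.
  have -> : beta lam s = beta sigma s by rewrite /beta out // lt_st.
  exact: beta_lt.
by apply: le_lt_trans (beta_le lam le_ts) _; rewrite /beta; lia.
Qed.

Lemma strip_free d lam sigma t i : strip d lam sigma t i ->
  forall s, beta lam s != beta lam i + d%:Z.
Proof.
by move=> /strip_split H s; have := H s; case: ifP => _ ?; apply/eqP; lia.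
Qed.

Lemma strip_unique d lam sigma sigma' t t' i :
  strip d lam sigma t i -> strip d lam sigma' t' i -> sigma = sigma'.
Proof.
move=> str str'.
have Et : t' = t.
  have H u u' : (forall s, if (s < u)%N then beta lam i + d%:Z < beta lam s
      else beta lam s < beta lam i + d%:Z) ->
      (forall s, if (s < u')%N then beta lam i + d%:Z < beta lam s
      else beta lam s < beta lam i + d%:Z) -> (u <= u')%N.
    move=> Hu Hu'; rewrite leqNgt; apply/negP => lt_u.
    by have := Hu u'; have := Hu' u'; rewrite lt_u ltnn; lia.
  by apply/eqP; rewrite eqn_leq !H //; apply: strip_split; eassumption.
subst t'; case: str str' => le_ti out mid E _ [_ out' mid' E' _].
apply: eq_partition => s.
have [H|] := boolP ((s < t) || (i < s))%N; first by rewrite out // out'.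
rewrite negb_or -!leqNgt => /andP[]; rewrite leq_eqVlt => /predU1P[<- _|].
  by lia.
by case: s => // s lt_ts lt_si; rewrite mid ?mid' //; lia.
Qed.

Lemma strip_last_row d d' lam sigma t t' i i' :
  strip d lam sigma t i -> strip d' lam sigma t' i' -> i = i'.
Proof.
move=> str str'; case: (str) (str') => le_ti out _ _ _ [le_ti' out' _ _ _].
have := strip_row str (s := i); have := strip_row str' (s := i').
rewrite le_ti le_ti' !leqnn => /(_ isT) lt_i' /(_ isT) lt_i.
case: (ltngtP i i') => // lt.
  by have := out i'; rewrite lt orbT => /(_ isT); lia.
by have := out' i; rewrite lt orbT => /(_ isT); lia.
Qed.

Lemma strip_bounds d lam sigma t i : strip d lam sigma t i ->
  [/\ (i < size lam + d)%N, (size sigma <= size lam + d)%N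
    & forall s, (nth 0%N sigma s <= nth 0%N lam 0 + d)%N].
Proof.
case=> le_ti out mid E top.
have le_t : (t <= size lam)%N.
  case: t {mid} le_ti out E top => // t le_ti out E top.
  rewrite -nth_parts_gt0 -out ?ltnSn //.
  by have := nth_parts_le sigma (leqnSn t); lia.
have lt_i : (i < size lam + d)%N.
  by have := nth_parts_le lam le_ti; lia.
have le_top : (nth 0%N sigma t <= nth 0%N lam 0 + d)%N.
  by have := nth_parts_le lam (leq0n i); lia.
split=> //.
  rewrite leqNgt -nth_parts_gt0 out; last lia.
  by rewrite nth_parts_gt0; lia.
move=> s; have := nth_parts_le lam (leq0n s).
have [/out->|] := boolP ((s < t) || (i < s))%N; first lia.
rewrite negb_or -!leqNgt => /andP[]; rewrite leq_eqVlt => /predU1P[<- //|].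
case: s => // s lt_ts lt_si; rewrite mid; last lia.
by have := nth_parts_le lam (leq0n s); have := nth_parts_le lam le_ti; lia.
Qed.

(** Conversely any jump to a free position is a border strip, where [t] is the
    first bead that is overtaken. *)
Lemma strip_exists d lam i : (0 < d)%N ->
  (forall s, (s < i)%N -> beta lam s != beta lam i + d%:Z) ->
  exists t sigma, strip d lam sigma t i.
Proof.
move=> d_gt0 free.
have ex : exists s, beta lam s < beta lam i + d%:Z by exists i; lia.
case: (ex_minnP ex) => t lt_t min_t.
have le_ti : (t <= i)%N by apply: min_t; lia.
pose f s := (if (s < t) || (i < s) then nth 0%N lam s else
  if s == t then nth 0%N lam i + d + t - i else (nth 0%N lam s.-1).+1)%N.
have lt_top : (nth 0%N lam t + i < nth 0%N lam i + d + t)%N.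
  by move: lt_t; rewrite /beta; lia.
have lt_prev : (0 < t)%N -> (nth 0%N lam i + d + t <= nth 0%N lam t.-1 + i)%N.
  move=> t_gt0; have lt_p : (t.-1 < t)%N by lia.
  have := free t.-1 ltac:(lia).
  have : ~~ (beta lam t.-1 < beta lam i + d%:Z).
    by apply/negP => /min_t; lia.
  by rewrite /beta; lia.
have anti s : (f s.+1 <= f s)%N.
  have le1 := nth_parts_le lam (leqnSn s).
  rewrite /f /=; have [lt_s|le_s] := ltnP s.+1 t.
    by rewrite (ltnW lt_s) /=; lia.
  have [lt_is|le_si] := ltnP i s.
    by rewrite (ltn_trans lt_is (ltnSn s)) !orbT.
  have [lt_is|le_si1] := ltnP i s.+1; rewrite ?orbT ?orbF /=.
    have [lt_st|le_ts] := ltnP s t => //=.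
    have [Es|ne] := eqVneq s t; first by subst s; lia.
    have lt_ps : (s.-1 <= s)%N by lia.
    by have := nth_parts_le lam lt_ps; lia.
  have [Es|ne] := eqVneq s.+1 t.
    by rewrite ifT; [have := lt_prev; rewrite -Es /=; lia|lia].
  rewrite ifF; last lia.
  have [Es|ne'] := eqVneq s t; first by subst s; lia.
  have lt_ps : (s.-1 <= s)%N by lia.
  by have := nth_parts_le lam lt_ps; lia.
have fout s : (size lam + i.+1 <= s)%N -> f s = 0%N.
  by move=> le_s; rewrite /f ifT ?nth_default //; lia.
have [sigma Es] := partition_exists anti fout.
exists t, sigma; split=> // [s H|s H||]; rewrite !Es /f.
- by rewrite H.
- by rewrite ifF ?ifF //=; lia.
- by rewrite ltnn eqxx (ltnNge i t) le_ti /=; lia.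
- by rewrite ltnn eqxx (ltnNge i t) le_ti /=; lia.
Qed.

(** Compare the Laplace expansions along the row that moves: the minors agree,
    only the signs of the cofactors differ. *)
Lemma det_move_row (A : comNzRingType) r (P Q : 'M[A]_r) (t i : 'I_r) :
  row t P = row i Q -> row' t P = row' i Q ->
  \det P = (-1) ^+ (t + i) * \det Q.
Proof.
move=> Er Er'; rewrite (expand_det_row P t) (expand_det_row Q i) mulr_sumr.
apply: eq_bigr => j _; rewrite /cofactor.
have -> : row' t (col' j P) = row' i (col' j Q).
  by apply/matrixP => a b; have /matrixP/(_ a (lift j b)) := Er'; rewrite !mxE.
have -> : P t j = Q i j by have /rowP/(_ j) := Er; rewrite !mxE.
rewrite [RHS]mulrCA; congr (_ * _); rewrite mulrA; congr (_ * _).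
rewrite -exprD -signr_odd -[RHS]signr_odd; congr (_ ^+ nat_of_bool _); lia.
Qed.

Lemma det_strip (A : comNzRingType) r (G : int -> 'I_r -> A) d lam sigma t
    (i : 'I_r) : strip d lam sigma t i ->
  \det (\matrix_(a, b) G (if a == i then beta lam a + d%:Z else beta lam a) b) =
  (-1) ^+ height sigma lam * \det (\matrix_(a, b) G (beta sigma a) b).
Proof.
move=> str; rewrite (strip_height str).
case: (str) => le_ti out mid _ _.
have lt_tr : (t < r)%N by apply: leq_ltn_trans (ltn_ord i).
rewrite (@det_move_row _ _ _ (\matrix_(a, b) G (beta sigma a) b) i (Ordinal lt_tr)).
- congr (_ * _); rewrite -signr_odd -[RHS]signr_odd /=.
  by congr (_ ^+ nat_of_bool _); lia.
- by apply/rowP => b; rewrite !mxE eqxx (strip_top str).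
apply/matrixP => a b; rewrite !mxE eq_sym (negPf (neq_lift _ _)); congr G.
rewrite /beta /= /bump.
have [le_ta|lt_at] := leqP t a; have [le_ia|lt_ia] := leqP i a.
- by rewrite !add1n out //; lia.
- by rewrite add1n add0n mid; lia.
- lia.
- by rewrite !add0n out // lt_at.
Qed.

(** A jump onto an occupied position gives two equal rows, hence a zero
    determinant; the other jumps correspond to the border strips. *)
Lemma strip_det_sum (A : comNzRingType) r (G : int -> 'I_r -> A) d lam :
  (0 < d)%N -> (size lam + d <= r)%N ->
  \sum_(i < r)
    \det (\matrix_(a, b) G (if a == i then beta lam a + d%:Z else beta lam a) b)
  = \sum_(sigma \in [set sigma | adds_border_strip d lam sigma])
      (-1) ^+ height sigma lam * \det (\matrix_(a, b) G (beta sigma a) b).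
Proof.
move=> d_gt0 le_r.
pose free (i : 'I_r) := [forall s : 'I_r, beta lam s != beta lam i + d%:Z].
rewrite (bigID free) /= [X in _ + X]big1 ?addr0 => [|i]; last first.
  rewrite negb_forall => /existsP[s /negPn/eqP Es].
  have ne : s != i by apply/eqP => E; move: Es; rewrite E; lia.
  apply: (determinant_alternate ne) => b; rewrite !mxE (negPf ne) eqxx.
  by rewrite Es.
have ex i : exists sigma, free i -> exists t, strip d lam sigma t i.
  have [/forallP Hi|nHi] := boolP (free i); last by exists lam.
  have [|t [sigma str]] := @strip_exists d lam i d_gt0; last first.
    by exists sigma; exists t.
  by move=> s lt_si; apply: (Hi (Ordinal (ltn_trans lt_si (ltn_ord i)))).
have [f Ef] := choice ex.
rewrite (@reindex_fsbig _ _ _ _ _ f [set` free]); last first.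
  split.
  - by move=> i /= /Ef[t str]; apply: strip_adds str.
  - move=> i j; rewrite !inE => /Ef[t str] /Ef[t' str'] E.
    by apply: val_inj; rewrite E in str; apply: strip_last_row str str'.
  - move=> sigma /= /(adds_strip d_gt0)[t [i str]].
    have [lt_i _ _] := strip_bounds str.
    have free_i : free (Ordinal (leq_trans lt_i le_r)).
      by apply/forallP => s; have := strip_free str s.
    exists (Ordinal (leq_trans lt_i le_r)) => //.
    by have [t' str'] := Ef _ free_i; apply: strip_unique str' str.
rewrite -(@bigfs _ _ _ _ (index_enum 'I_r)) ?index_enum_uniq // => [|i _];
  last by rewrite mem_index_enum.
by apply: eq_bigr => i /Ef[t str]; apply: det_strip str.
Qed.

End StripSum.

(** * Extraction of one coefficient *)

Section Coefficient.
Variables (I : choiceType) (m : {cmonom I}).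
Local Notation s := (enum_fset (finsupp m)).
Local Notation D := (size s).

(** The substitution that sends the variables absent from [m] to 0. *)
Definition support_var (v : I) : mpoly D int :=
  if v \in s then 'X_[ [multinom (tnth (in_tuple s) i == v : nat) | i < D] ]
  else 0.

Definition support_monomial : multinom D :=
  [multinom m (tnth (in_tuple s) i) | i < D].

Lemma big_mmulE (J : finType) (P : pred J) (v : J -> I) x :
  (\big[mmul/mone]_(j | P j) ucm (v j)) x = (\sum_(j | P j) (v j == x))%N.
Proof.
rewrite (big_morph (fun c : {cmonom I} => c x) (id1 := 0%N) (op1 := addn)).
- by apply: eq_bigr => j _; rewrite cmU.
- by move=> a b; rewrite cmM.
- by rewrite cm1.
Qed.

Lemma coeff_prod_support_var (J : finType) (P : pred J) (v : J -> I) :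
  (\prod_(j | P j) support_var (v j))@_support_monomial =
  ((\big[mmul/mone]_(j | P j) ucm (v j)) == m)%:R.
Proof.
have [/forallP vP|] := boolP [forall j, P j ==> (v j \in s)]; last first.
  rewrite negb_forall => /existsP[j]; rewrite negb_imply => /andP[Pj nv].
  rewrite (bigD1 j) //= {1}/support_var (negPf nv) mul0r mcoeff0.
  rewrite (_ : _ == m = false) //; apply/negP => /cmP /(_ (v j)).
  rewrite big_mmulE (bigD1 j) //= eqxx add1n.
  by have /eqP -> : m (v j) == 0%N by rewrite cmE_eq0.
have -> : \prod_(j | P j) support_var (v j) =
    'X_[\big[mnm_add/mnm0]_(j | P j)
          [multinom (tnth (in_tuple s) i == v j : nat) | i < D] ].
  rewrite (big_morph (fun k : multinom D => 'X_[k] : mpoly D int)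
    (@mpolyXD _ _) (mpolyX0 _ _)).
  by apply: eq_bigr => j Pj; rewrite /support_var; have /implyP -> := vP j.
rewrite mcoeffX; congr (nat_of_bool _)%:R; apply/eqP/cmP.
  move/mnmP => H x; rewrite big_mmulE.
  have [/tnthP[i ->]|nx] := boolP (x \in in_tuple s).
    have := H i; rewrite mnm_sumE mnmE => <-; apply: eq_bigr => j _.
    by rewrite mnmE eq_sym.
  rewrite big1 => [|j Pj]; last first.
    have /implyP/(_ Pj) := vP j.
    by case: eqP => // ->; rewrite (negPf nx).
  by apply/esym/eqP; rewrite cmE_eq0.
move=> H; apply/mnmP => i; rewrite mnm_sumE mnmE -H big_mmulE.
by apply: eq_bigr => j _; rewrite mnmE eq_sym.
Qed.

End Coefficient.

(** * Tableaux as arrays *)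

Section Transfer.
Variables (r' c' W : nat) (sigma : int_partition).
Local Notation r := r'.+1.
Local Notation c := c'.+1.
Hypothesis sigma_r : (size sigma <= r)%N.
Hypothesis sigma_c : forall i, (nth 0%N sigma i <= c)%N.

Definition shape_of : {ffun 'I_r -> 'I_c.+1} :=
  [ffun i : 'I_r => inord (nth 0%N sigma i)].

Lemma shape_ofE i : shape_of i = nth 0%N sigma i :> nat.
Proof. by rewrite ffunE inordK // ltnS. Qed.

Lemma rowlen_shape_of i : rowlen shape_of i = nth 0%N sigma i.
Proof.
have [lt_ir|le_ri] := ltnP i r.
  by rewrite (rowlen_ord _ (Ordinal lt_ir)) shape_ofE.
by rewrite rowlen_default // nth_default // (leq_trans sigma_r).
Qed.

Lemma shape_of_antitone : antitone shape_of.
Proof. by move=> i; rewrite !rowlen_shape_of nth_parts_le. Qed.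

Definition cell (b : nat * nat) : 'I_r * 'I_c := (inord b.1, inord b.2).

Lemma in_range b : b \in diagram sigma -> (b.1 < r)%N /\ (b.2 < c)%N.
Proof.
rewrite in_diagram => lt_b; split; last exact: leq_trans lt_b _.
by apply: leq_trans sigma_r; rewrite -nth_parts_gt0 (leq_ltn_trans _ lt_b).
Qed.

Lemma cellK b : b \in diagram sigma ->
  ((cell b).1 : nat, (cell b).2 : nat) = b.
Proof. by case: b => i j /in_range[/= lt_i lt_j]; rewrite !inordK. Qed.

Lemma cell_inside b : b \in diagram sigma ->
  ((cell b).2 < shape_of (cell b).1)%N.
Proof. by move=> inD; have := inD; rewrite -{1}(cellK inD) in_diagram shape_ofE. Qed.

Lemma big_diagram (T : Type) (idx : T) (op : Monoid.com_law idx)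
    (F : nat * nat -> T) :
  \big[op/idx]_(b : diagram sigma) F (val b) =
  \big[op/idx]_(p : 'I_r * 'I_c | (p.2 < shape_of p.1)%N) F (p.1 : nat, p.2 : nat).
Proof.
rewrite (reindex_omap (fun b : diagram sigma => cell (val b))
  (fun p => insub (p.1 : nat, p.2 : nat))) /=; last first.
  case=> i j /=; rewrite shape_ofE => lt_j.
  have inD : (i : nat, j : nat) \in diagram sigma by rewrite in_diagram.
  rewrite insubT /=; congr Some; rewrite /cell /=.
  by congr pair; apply: val_inj; rewrite /= inordK.
apply: eq_big => [b|b _]; last by rewrite cellK // valP.
by rewrite cell_inside ?valP // cellK ?valP // valK eqxx.
Qed.

Local Notation array := {ffun 'I_r * 'I_c -> 'I_W.+1}.

Definition filling_of (T : array) : filling sigma :=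
  [ffun b => T (cell (val b)) : nat].

Definition array_of (T : filling sigma) : array :=
  [ffun p : 'I_r * 'I_c => oapp (fun b : diagram sigma => inord (T b)) ord0
               (insub (p.1 : nat, p.2 : nat))].

Lemma array_of_inside (T : filling sigma) (i : 'I_r) (j : 'I_c)
    (inD : (i : nat, j : nat) \in diagram sigma) :
  (T [` inD]%fset <= W)%N -> array_of T (i, j) = T [` inD]%fset :> nat.
Proof. by move=> le_W; rewrite ffunE /= insubT /= inordK. Qed.

Lemma filling_ofE (T : array) (i : 'I_r) (j : 'I_c)
    (inD : (i : nat, j : nat) \in diagram sigma) :
  filling_of T [` inD]%fset = T (i, j).
Proof.
by rewrite ffunE /cell /=; congr (nat_of_ord (T (_, _)));
  apply: val_inj; rewrite /= inordK.
Qed.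

Lemma array_ofK (T : filling sigma) : (forall b, (T b <= W)%N) ->
  filling_of (array_of T) = T.
Proof.
move=> le_W; apply/ffunP => b; rewrite ffunE ffunE /= cellK ?valP // valK /=.
by rewrite inordK ?ltnS ?le_W.
Qed.

Lemma filling_of_inj : {in tableau W shape_of &, injective filling_of}.
Proof.
move=> T U /tableauP[T0 _ _ _] /tableauP[U0 _ _ _] E; apply/ffunP => -[i j].
apply: val_inj => /=; have [inD|] := boolP ((i : nat, j : nat) \in diagram sigma).
  by rewrite -!filling_ofE E.
rewrite in_diagram /= -shape_ofE => nD; have := T0 i j; have := U0 i j.
by rewrite (negPf nD) => /negbFE/eqP-> /negbFE/eqP->.
Qed.

Lemma filling_of_ssyt (T : array) : tableau W shape_of T -> is_ssyt (filling_of T).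
Proof.
case/tableauP => T0 _ Tr Tc.
have n0 (b : diagram sigma) : T (cell (val b)) != 0%N :> nat.
  by rewrite T0; apply: cell_inside (valP b).
have lt_r (b : diagram sigma) : ((val b).1 < r)%N by case: (in_range (valP b)).
have lt_c (b : diagram sigma) : ((val b).2 < c)%N by case: (in_range (valP b)).
split=> [b|b e Eb lt_b|b e Eb lt_b]; rewrite !ffunE.
- by rewrite lt0n.
- have := n0 e; rewrite /cell Eb => n0e; apply: Tr => //.
  by rewrite !inordK.
- have := n0 e; rewrite /cell Eb => n0e; apply: Tc => //.
  by rewrite !inordK.
Qed.

Lemma array_of_tableau (T : filling sigma) : is_ssyt T -> (forall b, (T b <= W)%N) ->
  tableau W shape_of (array_of T).
Proof.
move=> [T0 Tr Tc] le_W.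
have nD0 (i : 'I_r) (j : 'I_c) : array_of T (i, j) != 0%N :> nat ->
    (i : nat, j : nat) \in diagram sigma.
  by apply: contraR => nD; rewrite ffunE /= insubF //; apply/negbTE.
apply/tableauP; split.
- move=> i j; rewrite shape_ofE -(in_diagram sigma (_, _)).
  apply/idP/idP => [/nD0//|inD].
  by rewrite (@array_of_inside T _ _ inD) // -lt0n.
- by move=> b; rewrite -ltnS ltn_ord.
- move=> i j k lt_jk n0; have inD := nD0 _ _ n0.
  have inD' : (i : nat, j : nat) \in diagram sigma.
    by move: inD; rewrite !in_diagram; apply: ltn_trans.
  by rewrite (@array_of_inside T _ _ inD') // (@array_of_inside T _ _ inD) // Tr.
- move=> i k j lt_ik n0; have inD := nD0 _ _ n0.
  have inD' : (i : nat, j : nat) \in diagram sigma.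
    move: inD; rewrite !in_diagram /= => lt_j; apply: leq_trans lt_j _.
    by apply: nth_parts_le; apply: ltnW.
  by rewrite (@array_of_inside T _ _ inD') // (@array_of_inside T _ _ inD) // Tc.
Qed.

End Transfer.

(** * The vanishing of the signed sum *)

Local Open Scope classical_set_scope.
Local Open Scope ring_scope.

Section ContentVar.
Variables (n : nat) (l : int).

Lemma content_var_subproof (c : int) (w : nat) :
  n%:R * (w%:R + l%:~R * c%:~R / n%:R : rat) \is a Num.int.
Proof.
rewrite mulrDr rpredD //; first by rewrite rpredM ?natr_int.
have [->|n0] := eqVneq n 0%N; first by rewrite mul0r rpred0.
by rewrite mulrC divfK ?pnatr_eq0 // rpredM ?intr_int.
Qed.

Definition content_var (c : int) (w : nat) : loop_var n :=
  (c%:~R, exist _ (w%:R + l%:~R * c%:~R / n%:R) (content_var_subproof c w)).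

Lemma tableau_varE lam (T : filling lam) b :
  tableau_var n l T b = content_var (content (val b)) (T b).
Proof. by congr pair; apply: val_inj. Qed.

Lemma content_var_shift k c w : (1 < n)%N -> 0 <= l ->
  content_var (c + (k * n)%N%:Z) w = content_var c (w + k * `|l|)%N.
Proof.
move=> n1 l0; congr pair.
  by rewrite intrD -pmulrn natrM pchar_Zp // mulr0 addr0.
apply: val_inj => /=; rewrite intrD -pmulrn !natrD !natrM natr_absz ger0_norm //.
by field; rewrite pnatr_eq0; lia.
Qed.

Lemma content_var_weight c w : (0 < n)%N ->
  n%:R * val (content_var c w).2 = (n%:Z * w%:Z + l * c)%:~R :> rat.
Proof.
move=> n0 /=; rewrite intrD !intrM -!pmulrn.
by field; rewrite pnatr_eq0; lia.
Qed.

End ContentVar.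

Section SchurCoefficient.
Variables (R : comNzRingType) (n : nat) (l : int) (m : {cmonom (loop_var n)}).
Variables (r' c' W : nat) (sigma : int_partition).
Hypothesis sigma_r : (size sigma <= r'.+1)%N.
Hypothesis sigma_c : forall i, (nth 0%N sigma i <= c'.+1)%N.
Hypothesis W_large : forall c w, - r'.+1%:Z < c ->
  content_var n l c w \in finsupp m -> (w <= W)%N.

(** The substitution loses nothing that matters for the coefficient of [m]:
    tableaux with another monomial contribute 0 to it or vanish altogether, and
    a tableau with monomial [m] has its entries bounded by [W]. *)
Lemma shifted_loop_schur_coeff :
  shifted_loop_schur R n l sigma m =
  ((tableau_sum W (fun c w => support_var m (content_var n l c w))
      W (shape_of r' c' sigma))@_(support_monomial m))%:~R.
Proof.
have monE (T : {ffun 'I_r'.+1 * 'I_c'.+1 -> 'I_W.+1}) :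
    tableau_monomial n l (filling_of sigma T) =
    \big[mmul/mone]_(p : 'I_r'.+1 * 'I_c'.+1 | (p.2 < shape_of r' c' sigma p.1)%N)
       ucm (content_var n l (p.2%:Z - p.1%:Z) (T p)).
  rewrite /tableau_monomial.
  transitivity (\big[mmul/mone]_(b : diagram sigma)
     ucm (content_var n l (content (val b)) (T (cell r' c' (val b))))).
    by apply: eq_bigr => b _; rewrite tableau_varE ffunE.
  rewrite (big_diagram sigma_r sigma_c _
    (fun b => ucm (content_var n l (content b) (T (cell r' c' b))))).
  apply: eq_bigr => -[i j] _; rewrite /cell /content /=.
  congr (ucm (content_var _ _ _ (T (_, _)))); apply: val_inj; rewrite /= inordK //.
rewrite /tableau_sum raddf_sum rmorph_sum /=.
under eq_bigr => T _ do rewrite coeff_prod_support_var -monE natz.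
rewrite /shifted_loop_schur /series_sum.
pose s := [seq filling_of sigma T |
  T <- enum (tableau (W := W) W (shape_of r' c' sigma))].
rewrite (fsbigE s).
- rewrite big_seq_cond.
  rewrite (eq_bigl (fun T => T \in s)); last first.
    move=> T; rewrite andb_idr // => /mapP[U]; rewrite mem_enum => tabU ->.
    by rewrite inE; apply: filling_of_ssyt.
  rewrite -big_seq big_map big_enum /=; apply: eq_bigr => T _.
  by rewrite /monomial_series eq_sym; case: eqP.
- rewrite map_inj_in_uniq ?enum_uniq // => T U; rewrite !mem_enum.
  exact: filling_of_inj.
- by move=> T /= /mapP[U]; rewrite mem_enum => tabU ->; apply: filling_of_ssyt.
move=> T ssT nT; rewrite /monomial_series; case: eqP => // mT; case/negP: nT.
have le_W b : (T b <= W)%N.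
  apply: (@W_large (content (val b))).
    have [lt_b _] := in_range sigma_r sigma_c (valP b).
    by move: lt_b; rewrite /content; case: (val b) => i j /=; lia.
  rewrite -cmE_neq0 mT /tableau_monomial (bigD1 b) //= cmM cmU tableau_varE.
  by rewrite eqxx.
rewrite -(array_ofK sigma_r sigma_c le_W); apply: map_f; rewrite mem_enum.
exact: array_of_tableau.
Qed.

End SchurCoefficient.

Lemma support_weight_bound (n : nat) (m : {cmonom (loop_var n)}) :
  exists K : nat, forall v, v \in finsupp m -> val v.2 <= K%:R.
Proof.
exists (\sum_(v <- finsupp m) `|Num.ceil (val v.2)|)%N => v vm.
rewrite (big_rem v) //= natrD; apply: ler_wpDr; first exact: ler0n.
apply: le_trans (Num.Theory.ceil_ge _) _.
by rewrite natr_absz ler_int ler_norm.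
Qed.

Theorem theorem2 (R : comNzRingType) (n k : nat) (l : int)
    (lam : int_partition)
    (hn : (1 <= n)%N) (hk : (1 <= k)%N) (hl : 0 <= l < n%:Z) (hl0 : l != 0) :
  (0 : power_series R n) =
  \sum_(sigma \in [set sigma | adds_border_strip (k * n) lam sigma])
     (-1) ^+ height sigma lam *: shifted_loop_schur R n l sigma.
Proof.
have finA := finite_adds_border_strip (k * n) lam.
rewrite fsbig_finite // fct_sumE; apply/funext => m; rewrite -fsbig_finite //.
have n1 : (1 < n)%N by lia.
have [K leK] := support_weight_bound m.
have [L El] : exists L : nat, l = L%:Z by exists `|l|%N; lia.
set d := (k * n)%N in finA *.
(* The summands [size lam + d] make room for all the border strips; as
   [L < n], the others ensure [W <= r'.+1] for the [W] below. *)
pose r' := (size lam + d + K.+1 * n + L * d)%N.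
pose c' := (nth 0 lam 0 + d)%N.
pose W := (K + (L * (r'.+1 + d)) %/ n).+1.
pose y c w := support_var m (content_var n l c w).
have light c w : content_var n l c w \in finsupp m ->
    (n%:Z * w%:Z + L%:Z * c <= n%:Z * K%:Z).
  move/leK => le_w; rewrite -(ler_int rat) -El -content_var_weight; last lia.
  by rewrite intrM ler_pM2l ?ltr0n.
have y0 c w : n%:Z * K%:Z < n%:Z * w%:Z + L%:Z * c -> y c w = 0.
  by move=> lt_w; rewrite /y /support_var ifF //; apply/negP => /light; lia.
have d_gt0 : (0 < d)%N by rewrite muln_gt0 hk hn.
have Wn : (K * n + L * (r'.+1 + d) < W * n)%N.
  rewrite /W addSn mulSn mulnDl; have := ltn_ceil (L * (r'.+1 + d)) hn; lia.
have W_large c w : - r'.+1%:Z < c ->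
    content_var n l c w \in finsupp m -> (w <= W)%N.
  move=> lt_c /light le_w; rewrite leqNgt; apply/negP => lt_w.
  have H1 : (W%:Z + 1) * n%:Z <= n%:Z * w%:Z by rewrite mulrC ler_wpM2l //; lia.
  have H2 : L%:Z * (- r'%:Z) <= L%:Z * c by rewrite ler_wpM2l //; lia.
  by move: Wn; rewrite mulnDr mulnS; nia.
have in_box sigma : adds_border_strip d lam sigma ->
    (size sigma <= r'.+1)%N /\ forall i, (nth 0%N sigma i <= c'.+1)%N.
  move/(adds_strip d_gt0) => [t [i /strip_bounds[_ le_size le_nth]]].
  by split=> [|a]; [rewrite /r'; lia|rewrite (leq_trans (le_nth a))].
pose G (q : int) (b : 'I_r'.+1) := hcomplete y 0 W (- b%:Z) q.
have sum0 : \sum_(sigma \in [set sigma | adds_border_strip d lam sigma])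
    (-1) ^+ height sigma lam * \det (\matrix_(a, b) G (beta sigma a) b) = 0.
  rewrite -strip_det_sum //; last by rewrite /r'; lia.
  apply: (@sum_det_shift_row0 _ y r' W d (k * L)%N _ _ _ _ _ (n * K)%N%:Z _
            (fun a => beta lam a)).
  (* [W <= r'.+1]: with [L + 1 <= n], the part [x] of [r'] beyond [K] satisfies
       [L (x + K + 1 + d) <= (L + 1) x <= n x]. *)
  - have Kn : (K.+1 * L.+1 <= K.+1 * n)%N by rewrite leq_mul2l; lia.
    have [x Ex le_x] : exists2 x, r' = (x + K)%N & (L * (K.+1 + d) <= x)%N.
      by exists (r' - K)%N; rewrite /r'; lia.
    have xn : (x * L.+1 <= x * n)%N by rewrite leq_mul2l; lia.
    have le_div : (L * (r'.+1 + d) <= x * n)%N by rewrite Ex; lia.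
    by have := leq_div2r n le_div; rewrite mulnK // /W; lia.
  - have : (k * L * n < W * n)%N by apply: leq_ltn_trans Wn; rewrite /d; nia.
    by rewrite ltn_pmul2r // => /ltnW.
  - by rewrite /d ltn_pmul2l //; lia.
  - move=> c v _; have l_ge0 : 0 <= l by case/andP: hl.
    have absl : (`|l|)%N = L by rewrite El.
    have E := content_var_shift k c v n1 l_ge0.
    rewrite absl in E.
    by congr (support_var m _); exact: E.
  - move=> c v le_c lt_v; apply: y0.
    have H1 : (W%:Z + 1) * n%:Z <= n%:Z * v%:Z by rewrite mulrC ler_wpM2l //; lia.
    have H2 : L%:Z * (- (r'.+1 + d)%N%:Z) <= L%:Z * c by rewrite ler_wpM2l.
    by nia.
  - move=> c v le_c v0; apply: y0.
    have H1 : n%:Z * 1 <= n%:Z * v%:Z by rewrite ler_wpM2l //; lia.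
    have H2 : 1 * c <= L%:Z * c by rewrite ler_wpM2r //; lia.
    by nia.
  - by move=> a; rewrite /beta; have := ltn_ord a; lia.
transitivity (((\sum_(sigma \in [set sigma | adds_border_strip d lam sigma])
    (-1) ^+ height sigma lam * \det (\matrix_(a, b) G (beta sigma a) b))
    @_(support_monomial m))%:~R : R).
  by rewrite sum0 mcoeff0.
rewrite !fsbig_finite // raddf_sum rmorph_sum /=.
apply: eq_big_seq => sigma; rewrite in_fset_set // inE => /= adds.
have [le_r le_c] := in_box sigma adds.
have -> : \det (\matrix_(a, b) G (beta sigma a) b) =
    tableau_sum W y W (shape_of r' c' sigma).
  rewrite (tableau_sum_jacobi_trudi _ (leqnn W) (shape_of_antitone le_r le_c)).
  congr (\det _); apply/matrixP => a b; rewrite !mxE /G /beta.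
  by rewrite shape_ofE.
rewrite -[RHS]/(_ * _) (shifted_loop_schur_coeff R le_r le_c W_large).
rewrite -signr_odd -[in RHS]signr_odd; case: odd;
  rewrite ?expr0 ?expr1 ?mul1r ?mulN1r //.
by rewrite mcoeffN rmorphN.
Qed.
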